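(* Let $N\ge2$, $\alpha,\beta>-1$, let $\{x_j,\omega_j\}_{j=0}^N$ be the JGL nodes and weights, and let $Q_j^\mu$ be the Caputo fractional Birkhoff basis polynomials defined below. (i) For $\mu\in(0,1)$ and $1\le j\le N$, $$ Q_j^\mu(x)=\frac{1}{(1+x_j)^{1-\mu}}\sum_{l=0}^{N-1}\frac{\Gamma(l-\mu+2)}{l!}\,\breve\xi_{lj}\int_{-1}^xP_l(t)\,dt, $$ where $\breve\xi_{lj}=\sum_{n=l}^{N-1}{}^{(\alpha,\beta)}C^{(\mu-1,1-\mu)}_{ln}\,\xi_{nj}$ and $$ \xi_{nj}=\frac{1}{\gamma_n^{(\alpha,\beta)}}\Big\{-\frac{c_j}{\beta+1}\frac{P_N^{(\alpha,\beta)}(-1)}{P_N^{(\alpha,\beta)}(x_j)}P_n^{(\alpha,\beta)}(-1)\,\omega_0+P_n^{(\alpha,\beta)}(x_j)\,\omega_j\Big\}, $$ with $c_j=1$ for $1\le j\le N-1$ and $c_N=\alpha+1$. (ii) For $\mu\in(1,2)$ and $1\le j\le N-1$, $$ Q_j^\mu(x)=\frac{1}{(1+x_j)^{2-\mu}}\sum_{l=0}^{N-2}\frac{\Gamma(l-\mu+3)}{l!}\,\breve\xi_{lj}\,\Phi_l(x), $$ where $\breve\xi_{lj}=\sum_{n=l}^{N-2}{}^{(\alpha,\beta)}C^{(\mu-2,2-\mu)}_{ln}\,\xi_{nj}$, $$ \xi_{nj}=\frac{1}{\gamma_n^{(\alpha,\beta)}}\Big\{\frac{(x_j-1)P_N^{(\alpha,\beta)}(-1)}{2(\beta+1)P_N^{(\alpha,\beta)}(x_j)}P_n^{(\alpha,\beta)}(-1)\,\omega_0-\frac{(1+x_j)P_N^{(\alpha,\beta)}(1)}{2(\alpha+1)P_N^{(\alpha,\beta)}(x_j)}P_n^{(\alpha,\beta)}(1)\,\omega_N+P_n^{(\alpha,\beta)}(x_j)\,\omega_j\Big\},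 $$ and $\Phi_l(x)=\frac{1+x}{2}\int_{-1}^1(t-1)P_l(t)\,dt+\int_{-1}^x(x-t)P_l(t)\,dt$.
   Context: For $\rho>0$, $(I_-^\rho u)(x)=\frac{1}{\Gamma(\rho)}\int_{-1}^x (x-y)^{\rho-1}u(y)\,dy$, $D^k=d^k/dx^k$, and for $\mu\in(k-1,k)$ the Caputo derivative is ${}^C D_-^\mu u=I_-^{k-\mu}(D^k u)$. Caputo fractional Birkhoff basis: for $\mu\in(0,1)$, $Q_j^\mu\in\mathcal P_N$ ($1\le j\le N$) satisfies ${}^C D_-^\mu Q_j^\mu(x_i)=\delta_{ij}$ ($1\le i\le N$) and $Q_j^\mu(-1)=0$; for $\mu\in(1,2)$, $Q_j^\mu\in\mathcal P_N$ ($1\le j\le N-1$) satisfies ${}^C D_-^\mu Q_j^\mu(x_i)=\delta_{ij}$ ($1\le i\le N-1$) and $Q_j^\mu(\pm1)=0$. Jacobi polynomials are in Szegő's normalization: $P_n^{(\alpha,\beta)}(x)=\frac{\Gamma(n+\alpha+1)}{n!\Gamma(\alpha+1)}\,{}_2F_1\big(-n,n+\alpha+\beta+1;\alpha+1;\tfrac{1-x}{2}\big)$, $P_0^{(\alpha,\beta)}=1$, $P_n=P_n^{(0,0)}$. For $\alpha,\beta>-1$, $\gamma_n^{(\alpha,\beta)}=\frac{2^{\alpha+\beta+1}\Gamma(n+\alpha+1)\Gamma(n+\beta+1)}{(2n+\alpha+\beta+1)\,n!\,\Gamma(n+\alpha+\beta+1)}$. Connection coefficients: for $\alpha,\beta,a,b>-1$,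 ${}^{(\alpha,\beta)}C^{(a,b)}_{ln}$ are the unique numbers with $P_n^{(\alpha,\beta)}=\sum_{l=0}^n {}^{(\alpha,\beta)}C^{(a,b)}_{ln}P_l^{(a,b)}$. JGL nodes $x_0<\dots<x_N$ are the zeros of $(1-x^2)\frac{d}{dx}P_N^{(\alpha,\beta)}$ ($x_0=-1$, $x_N=1$) and the weights $\omega_j$ make $\int_{-1}^1\phi(1-x)^\alpha(1+x)^\beta dx=\sum_j\phi(x_j)\omega_j$ exact for $\phi\in\mathcal P_{2N-1}$. *)

(* Defs.v *)
From Stdlib Require Import Reals Lra ClassicalEpsilon Arith Factorial.
Open Scope R_scope.

(* Euler's Gamma function via Gauss's product limit
   Gamma(x) = lim_{n->oo} n^x n! / (x (x+1) ... (x+n)),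
   valid for x not in {0,-1,-2,...}. *)
Definition gauss_seq (x : R) (n : nat) : R :=
  Rpower (INR (S n)) x * INR (fact (S n)) /
  prod_f_R0 (fun k => x + INR k) (S n).

Definition Gamma (x : R) : R :=
  epsilon (inhabits 0) (fun g => Un_cv (gauss_seq x) g).

(* Proper Riemann integral value (the functions used are polynomials). *)
Definition RInt (f : R -> R) (a b : R) : R :=
  epsilon (inhabits 0)
    (fun l => exists pr : Riemann_integrable f a b, RiemannInt pr = l).

Definition improper_int (f : R -> R) (a b l : R) : Prop :=
  forall eps, eps > 0 -> exists delta, delta > 0 /\
    forall u v, a < u -> u < a + delta -> b - delta < v -> v < b ->
      exists pr : Riemann_integrable f u v, Rabs (RiemannInt pr - l) < eps.

Definition IInt (f : R -> R) (a b : R) : R :=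
  epsilon (inhabits 0) (fun l => improper_int f a b l).

Definition RL_int (rho : R) (u : R -> R) (x : R) : R :=
  / Gamma rho * IInt (fun y => Rpower (x - y) (rho - 1) * u y) (-1) x.

(* Caputo derivative of order mu in (k-1,k): I_-^{k-mu} (D^k u);
   Dku is the k-th derivative of u. *)
Definition caputo (k : nat) (mu : R) (Dku : R -> R) (x : R) : R :=
  RL_int (INR k - mu) Dku x.

Fixpoint rfact (a : R) (k : nat) : R :=
  match k with O => 1 | S k' => rfact a k' * (a + INR k') end.

(* Jacobi polynomial, Szego normalization:
   Gamma(n+a+1)/(n! Gamma(a+1)) 2F1(-n, n+a+b+1; a+1; (1-x)/2)
   (the hypergeometric series terminates at k = n). *)
Definition Jacobi (a b : R) (n : nat) (x : R) : R :=
  Gamma (INR n + a + 1) / (INR (fact n) * Gamma (a + 1)) *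
  sum_f_R0 (fun k => rfact (- INR n) k * rfact (INR n + a + b + 1) k /
                     (rfact (a + 1) k * INR (fact k)) * ((1 - x) / 2) ^ k) n.

Definition Legendre (n : nat) (x : R) : R := Jacobi 0 0 n x.

(* gamma_n^{(a,b)}; for n = 0 the factor (a+b+1) Gamma(a+b+1) is written
   as Gamma(a+b+2) (its value, also covering a+b+1 = 0). *)
Definition gamJ (a b : R) (n : nat) : R :=
  match n with
  | O => Rpower 2 (a + b + 1) * Gamma (a + 1) * Gamma (b + 1) / Gamma (a + b + 2)
  | _ => Rpower 2 (a + b + 1) * Gamma (INR n + a + 1) * Gamma (INR n + b + 1) /
         ((2 * INR n + a + b + 1) * INR (fact n) * Gamma (INR n + a + b + 1))
  end.

Definition peval (c : nat -> R) (n : nat) (x : R) : R :=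
  sum_f_R0 (fun k => c k * x ^ k) n.

Definition kron (i j : nat) : R := if Nat.eqb i j then 1 else 0.

(* Main.v *)
From Coquelicot Require Import Coquelicot.
Require Import Defs.
From Stdlib Require Import Reals Lra Lia ClassicalEpsilon FunctionalExtensionality Arith Factorial.
Open Scope R_scope.

(** Let [rho = k - mu] and let [u] be the [k]-th derivative of [Q_j].  The Riemann-Liouville
    integral of order [rho] maps the Legendre polynomial [P_l] to
    [l! / Gamma (l + rho + 1) * (1 + x)^rho * P_l^(-rho,rho)], so that expanding [u] in Legendre
    polynomials turns the interpolation conditions into the statement that a polynomial [G], with
    the same coefficients up to these factors, is a multiple of the Lagrange polynomial of the
    node [x_j].  The values of [G] at the remaining end points follow from the Jacobi differential
    equation, and the quadrature rule then yields the coefficients of [G] in the orthogonal basis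
    [P_n^(al,be)]; the connection coefficients convert them back to [P_l^(-rho,rho)].

    The norms [gamJ] rest on the Beta integral.  For the Gamma function given by Gauss' product,
    [n^a B(a, n + 1)] is exactly the Gauss product, and monotonicity of the Beta integral
    extends the limit to [n^a B(a, n + b)].  Orthogonality, the norms and the reflection
    [x -> -x] all come from one binomial recursion (lemma [hyp_flip]). *)

(** * Rising factorials and the Gamma function *)

(** The factor [(1 + x)^rho] vanishes at [-1], so the interpolation conditions say nothing about [G]
    there; this is why [G (-1)], and for [k = 2] also [G 1], has to be computed. [G] has degree at
    most [N - k] and is prescribed at [N - k + 1] nodes, so it is a multiple of a nodal polynomial
    divided by [x - x_j]. That nodal polynomial is [(1 - x) P_N'] for [k = 1] and [P_N'] for
    [k = 2]. The values at stake are therefore values of [P_N'] and [P_N''] at nodes, where the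
    differential equation loses one of its derivative terms and reduces them to values of [P_N]. In
    the quadrature sum only [x_j] and the end points without a condition survive, which explains the
    two terms of [xi] in the first formula and the three in the second.

    The Legendre basis fits because the parameters of [P_l^(0,0)] and of [P_l^(-rho,rho)] both add
    up to [0]: their expansions in powers of [1 + x] differ only by factors that the Beta integral
    supplies. *)

Lemma rfact_S_l (a : R) (k : nat) : rfact a (S k) = a * rfact (a + 1) k.
Proof.
  induction k as [|k IH].
  - simpl. ring.
  - change (rfact a (S (S k))) with (rfact a (S k) * (a + INR (S k))).
    rewrite IH, S_INR. simpl. ring.
Qed.

Lemma rfact_add (a : R) (m n : nat) :
  rfact a (m + n) = rfact a m * rfact (a + INR m) n.
Proof.
  induction n as [|n IH].
  - rewrite Nat.add_0_r. simpl. ring.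
  - rewrite Nat.add_succ_r. simpl. rewrite IH, plus_INR. ring.
Qed.

Lemma rfact_pos (a : R) (k : nat) : 0 < a -> 0 < rfact a k.
Proof.
  intros Ha; induction k as [|k IH]; simpl; [lra|].
  apply Rmult_lt_0_compat; [exact IH|]. pose proof (pos_INR k). lra.
Qed.

Lemma rfact_1 (k : nat) : rfact 1 k = INR (fact k).
Proof.
  induction k as [|k IH]; [reflexivity|].
  rewrite fact_simpl, mult_INR, <- IH, S_INR. simpl. ring.
Qed.

Lemma rfact_opp_nat (n k : nat) : (n < k)%nat -> rfact (- INR n) k = 0.
Proof.
  induction k as [|k IH]; intros H; [lia|]. simpl.
  destruct (Nat.eq_dec n k) as [->|Hk]; [ring|]. rewrite IH by lia. ring.
Qed.

(** Reverse the order of the factors and change all signs. *)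
Lemma rfact_opp (a : R) (k : nat) :
  rfact (- a - INR k) k = (-1) ^ k * rfact (a + 1) k.
Proof.
  induction k as [|k IH]; [simpl; ring|].
  rewrite rfact_S_l.
  replace (- a - INR (S k) + 1) with (- a - INR k) by (rewrite S_INR; ring).
  rewrite IH, S_INR. simpl. ring.
Qed.

Lemma fact_INR_pos (n : nat) : 0 < INR (fact n).
Proof. apply lt_0_INR, lt_O_fact. Qed.

Lemma prod_rfact (x : R) (n : nat) :
  prod_f_R0 (fun k => x + INR k) n = rfact x (S n).
Proof.
  induction n as [|n IH]; [simpl; ring|].
  change (rfact x (S (S n))) with (rfact x (S n) * (x + INR (S n))).
  rewrite <- IH. reflexivity.
Qed.

Lemma gauss_seqE (x : R) (n : nat) :
  gauss_seq x n = Rpower (INR (S n)) x * INR (fact (S n)) / rfact x (S (S n)).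
Proof. unfold gauss_seq. now rewrite prod_rfact. Qed.

Lemma Rpower_pos (a x : R) : 0 < Rpower a x.
Proof. apply exp_pos. Qed.

Lemma gauss_seq_pos (x : R) (n : nat) : 0 < x -> 0 < gauss_seq x n.
Proof.
  intros Hx. rewrite gauss_seqE. apply Rdiv_lt_0_compat.
  - apply Rmult_lt_0_compat; [apply Rpower_pos | apply fact_INR_pos].
  - now apply rfact_pos.
Qed.

(** * Convergence of Gauss' product *)

Lemma ln_le_sub1 (y : R) : 0 < y -> ln y <= y - 1.
Proof.
  intros Hy. pose proof (exp_ineq1_le (ln y)) as H. rewrite exp_ln in H; lra.
Qed.

(** Divided by [p^x] this is [(1 + 1/p)^x >= 1 + x/(p+1)], a consequence of
    [ln (1 + 1/p) >= 1/(p+1)] and [exp y >= 1 + y]. It expresses the growth of Gauss' sequence from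
    one index to the next. *)
Lemma Rpower_succ_ge (p x : R) :
  0 < p -> 0 <= x -> Rpower p x * (x + p + 1) <= Rpower (p + 1) x * (p + 1).
Proof.
  intros Hp Hx.
  assert (Hln : / (p + 1) <= ln (p + 1) - ln p).
  { pose proof (ln_le_sub1 (p / (p + 1))) as H.
    rewrite ln_div in H by lra.
    assert (0 < p / (p + 1)) by (apply Rdiv_lt_0_compat; lra).
    replace (p / (p + 1) - 1) with (- / (p + 1)) in H by (field; lra). lra. }
  assert (HE : Rpower (p + 1) x = Rpower p x * exp (x * (ln (p + 1) - ln p))).
  { unfold Rpower. rewrite <- exp_plus. f_equal. ring. }
  rewrite HE, Rmult_assoc.
  apply Rmult_le_compat_l; [left; apply Rpower_pos|].
  pose proof (exp_ineq1_le (x * (ln (p + 1) - ln p))) as H1.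
  assert (H2 : x * / (p + 1) <= x * (ln (p + 1) - ln p)) by (now apply Rmult_le_compat_l).
  apply Rle_trans with ((1 + x * / (p + 1)) * (p + 1)).
  - right. field. lra.
  - apply Rmult_le_compat_r; lra.
Qed.

(* The tangents of [exp] at [x * L], read at [0] and at [L]. *)
Lemma exp_convex_0 (x L : R) : 0 <= x <= 1 -> exp (x * L) <= 1 - x + x * exp L.
Proof.
  intros Hx.
  assert (H0 : exp (x * L) * (1 - x * L) <= 1).
  { pose proof (exp_ineq1_le (- (x * L))) as H.
    apply Rle_trans with (exp (x * L) * exp (- (x * L))).
    - apply Rmult_le_compat_l; [left; apply exp_pos | lra].
    - rewrite <- exp_plus, Rplus_opp_r, exp_0. lra. }
  assert (H1 : exp (x * L) * (1 + (L - x * L)) <= exp L).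
  { pose proof (exp_ineq1_le (L - x * L)) as H.
    apply Rle_trans with (exp (x * L) * exp (L - x * L)).
    - apply Rmult_le_compat_l; [left; apply exp_pos | lra].
    - rewrite <- exp_plus. right. f_equal. ring. }
  assert ((1 - x) * (exp (x * L) * (1 - x * L)) <= (1 - x) * 1)
    by (apply Rmult_le_compat_l; lra).
  assert (x * (exp (x * L) * (1 + (L - x * L))) <= x * exp L)
    by (apply Rmult_le_compat_l; lra).
  lra.
Qed.

(** Bernoulli's inequality [(1 + 1/q)^x <= 1 + x/q] for exponents in [[0,1]], from the convexity of
    [exp]. *)
Lemma Rpower_succ_le (q x : R) :
  0 < q -> 0 <= x <= 1 -> Rpower (q + 1) x * q <= Rpower q x * (x + q).
Proof.
  intros Hq Hx.
  assert (HE : Rpower (q + 1) x = Rpower q x * exp (x * ln ((q + 1) / q))).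
  { unfold Rpower. rewrite ln_div by lra. rewrite <- exp_plus. f_equal. ring. }
  rewrite HE, Rmult_assoc.
  apply Rmult_le_compat_l; [left; apply Rpower_pos|].
  pose proof (exp_convex_0 x (ln ((q + 1) / q)) Hx) as H.
  rewrite (exp_ln ((q + 1) / q)) in H by (apply Rdiv_lt_0_compat; lra).
  apply Rle_trans with ((1 - x + x * ((q + 1) / q)) * q).
  - apply Rmult_le_compat_r; lra.
  - right. field. lra.
Qed.

Lemma gauss_seq_growing (x : R) : 0 < x -> Un_growing (gauss_seq x).
Proof.
  intros Hx n. rewrite !gauss_seqE.
  set (p := INR (S n)).
  assert (Hp : 0 < p) by (apply lt_0_INR; lia).
  rewrite (fact_simpl (S n)), mult_INR, (S_INR (S n)). fold p.
  change (rfact x (S (S (S n)))) with (rfact x (S (S n)) * (x + INR (S (S n)))).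
  rewrite (S_INR (S n)). fold p.
  pose proof (rfact_pos x (S (S n)) Hx) as Hr.
  pose proof (fact_INR_pos (S n)) as Hf.
  pose proof (Rpower_succ_ge p x Hp (Rlt_le _ _ Hx)) as H.
  replace (Rpower p x * INR (fact (S n)) / rfact x (S (S n)))
    with ((Rpower p x * (x + p + 1)) * (INR (fact (S n)) / (rfact x (S (S n)) * (x + (p + 1)))))
    by (field; lra).
  replace (Rpower (p + 1) x * ((p + 1) * INR (fact (S n))) / (rfact x (S (S n)) * (x + (p + 1))))
    with ((Rpower (p + 1) x * (p + 1)) * (INR (fact (S n)) / (rfact x (S (S n)) * (x + (p + 1)))))
    by (field; lra).
  apply Rmult_le_compat_r; [|exact H].
  left. apply Rdiv_lt_0_compat; [assumption|]. apply Rmult_lt_0_compat; lra.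
Qed.

(** With [(p+1)^x] in place of [p^x], Gauss' product becomes decreasing for [x <= 1] and starts at
    [1/x]. This variant dominates the original and so bounds it. *)
Lemma gauss_upper (x : R) (p : nat) : 0 < x <= 1 ->
  Rpower (INR (S p)) x * INR (fact p) / rfact x (S p) <= / x.
Proof.
  intros Hx. induction p as [|p IH].
  - simpl. unfold Rpower. rewrite ln_1, Rmult_0_r, exp_0. right. field. lra.
  - eapply Rle_trans; [|exact IH].
    set (q := INR (S p)).
    assert (Hq : 0 < q) by (apply lt_0_INR; lia).
    rewrite (fact_simpl p), mult_INR, (S_INR (S p)). fold q.
    change (rfact x (S (S p))) with (rfact x (S p) * (x + INR (S p))). fold q.
    pose proof (rfact_pos x (S p) (proj1 Hx)) as Hr.
    pose proof (fact_INR_pos p) as Hf.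
    assert (H : Rpower (q + 1) x * q <= Rpower q x * (x + q)) by (apply Rpower_succ_le; lra).
    replace (Rpower (q + 1) x * (q * INR (fact p)) / (rfact x (S p) * (x + q)))
      with ((Rpower (q + 1) x * q) * (INR (fact p) / (rfact x (S p) * (x + q))))
      by (field; lra).
    replace (Rpower q x * INR (fact p) / rfact x (S p))
      with ((Rpower q x * (x + q)) * (INR (fact p) / (rfact x (S p) * (x + q))))
      by (field; lra).
    apply Rmult_le_compat_r; [|exact H].
    left. apply Rdiv_lt_0_compat; [assumption|]. apply Rmult_lt_0_compat; lra.
Qed.

Lemma ratio_cv (c : R) : 0 <= c -> Un_cv (fun n => INR (S n) / (INR (S n) + c)) 1.
Proof.
  intros Hc eps Heps.
  destruct (archimed_cor1 (eps / (c + 1))) as [M [HM HM0]].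
  { apply Rdiv_lt_0_compat; lra. }
  exists M. intros n Hn.
  assert (Hp : INR M <= INR (S n)) by (apply le_INR; lia).
  assert (HM1 : 0 < INR M) by (now apply lt_0_INR).
  unfold Rdist.
  replace (INR (S n) / (INR (S n) + c) - 1) with (- (c / (INR (S n) + c))) by (field; lra).
  rewrite Rabs_Ropp, Rabs_pos_eq by (apply Rdiv_le_0_compat; lra).
  apply Rmult_lt_reg_r with (INR (S n) + c); [lra|].
  unfold Rdiv at 1. rewrite Rmult_assoc, Rinv_l, Rmult_1_r by lra.
  apply (Rmult_lt_compat_r (INR M * (c + 1))) in HM; [|apply Rmult_lt_0_compat; lra].
  replace (/ INR M * (INR M * (c + 1))) with (c + 1) in HM by (field; lra).
  replace (eps / (c + 1) * (INR M * (c + 1))) with (eps * INR M) in HM by (field; lra).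
  assert (eps * INR M <= eps * (INR (S n) + c)) by (apply Rmult_le_compat_l; lra).
  lra.
Qed.

Lemma gauss_seq_succ (x : R) (n : nat) : 0 < x ->
  gauss_seq (x + 1) n = gauss_seq x n * (x * (INR (S n) / (INR (S n) + (x + 1)))).
Proof.
  intros Hx. rewrite !gauss_seqE.
  assert (Hp : 0 < INR (S n)) by (apply lt_0_INR; lia).
  rewrite Rpower_plus, Rpower_1 by assumption.
  rewrite (rfact_S_l x).
  change (rfact (x + 1) (S (S n))) with (rfact (x + 1) (S n) * (x + 1 + INR (S n))).
  pose proof (rfact_pos (x + 1) (S n)) as Hr.
  field. repeat split; lra.
Qed.

Lemma Un_cv_ext (u v : nat -> R) (l : R) :
  (forall n, u n = v n) -> Un_cv u l -> Un_cv v l.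
Proof.
  intros H Hu eps He. destruct (Hu eps He) as [M HM]. exists M. intros n Hn.
  rewrite <- H. now apply HM.
Qed.

Lemma Un_cv_const (c : R) : Un_cv (fun _ => c) c.
Proof.
  intros eps He. exists 0%nat. intros n _. unfold Rdist.
  rewrite Rminus_diag, Rabs_R0. lra.
Qed.

Lemma gauss_seq_succ_cv (x g : R) : 0 < x ->
  Un_cv (gauss_seq x) g -> Un_cv (gauss_seq (x + 1)) (x * g).
Proof.
  intros Hx Hg.
  apply Un_cv_ext with (fun n => gauss_seq x n * (x * (INR (S n) / (INR (S n) + (x + 1))))).
  { intros n. symmetry. now apply gauss_seq_succ. }
  replace (x * g) with (g * (x * 1)) by ring.
  apply CV_mult; [assumption|]. apply (CV_mult (fun _ => x)); [apply Un_cv_const|].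
  apply ratio_cv. lra.
Qed.

(** Monotone convergence settles [x <= 1], where [gauss_upper] applies; the functional equation
    carries convergence from [x - 1] to [x]. *)
Lemma gauss_seq_ex_cv (x : R) : 0 < x -> exists g, Un_cv (gauss_seq x) g.
Proof.
  intros Hx.
  assert (H : forall k x, 0 < x <= INR k + 1 -> exists g, Un_cv (gauss_seq x) g).
  { clear x Hx. induction k as [|k IH]; intros x Hx.
    - simpl in Hx. apply Un_cv_crit; [apply gauss_seq_growing; lra|].
      exists (/ x). intros y [n ->]. rewrite gauss_seqE.
      eapply Rle_trans; [|apply (gauss_upper x (S n)); lra].
      unfold Rdiv. apply Rmult_le_compat_r.
      { left. apply Rinv_0_lt_compat, rfact_pos. lra. }
      apply Rmult_le_compat_r; [left; apply fact_INR_pos|].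
      apply Rle_Rpower_l; [lra|]. split; [apply lt_0_INR; lia | apply le_INR; lia].
    - destruct (Rle_lt_dec x 1) as [H1|H1].
      + apply IH. pose proof (pos_INR k). lra.
      + rewrite S_INR in Hx. destruct (IH (x - 1)) as [g Hg]; [lra|].
        exists ((x - 1) * g). replace x with (x - 1 + 1) at 1 by ring.
        apply gauss_seq_succ_cv; [lra | assumption]. }
  destruct (INR_unbounded x) as [k Hk]. apply (H k). lra.
Qed.

Lemma Gamma_cv (x : R) : 0 < x -> Un_cv (gauss_seq x) (Gamma x).
Proof. intros Hx. unfold Gamma. apply epsilon_spec. now apply gauss_seq_ex_cv. Qed.

Lemma Gamma_pos (x : R) : 0 < x -> 0 < Gamma x.
Proof.
  intros Hx. apply Rlt_le_trans with (gauss_seq x 0); [now apply gauss_seq_pos|].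
  apply growing_ineq; [now apply gauss_seq_growing | now apply Gamma_cv].
Qed.

Lemma Gamma_succ (x : R) : 0 < x -> Gamma (x + 1) = x * Gamma x.
Proof.
  intros Hx. apply (UL_sequence (gauss_seq (x + 1))).
  - apply Gamma_cv. lra.
  - apply gauss_seq_succ_cv; [assumption | now apply Gamma_cv].
Qed.

Lemma Gamma_1 : Gamma 1 = 1.
Proof.
  apply (UL_sequence (gauss_seq 1)); [apply Gamma_cv; lra|].
  apply Un_cv_ext with (fun n => INR (S n) / (INR (S n) + 1)); [|apply ratio_cv; lra].
  intros n. rewrite gauss_seqE, rfact_1, (fact_simpl (S n)), mult_INR, (S_INR (S n)).
  assert (Hp : 0 < INR (S n)) by (apply lt_0_INR; lia).
  rewrite Rpower_1 by assumption.
  pose proof (fact_INR_pos (S n)). field. lra.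
Qed.

Lemma Gamma_rfact (x : R) (k : nat) : 0 < x ->
  Gamma (x + INR k) = Gamma x * rfact x k.
Proof.
  intros Hx. induction k as [|k IH].
  - simpl. rewrite Rplus_0_r. ring.
  - rewrite S_INR, <- Rplus_assoc, Gamma_succ, IH by (pose proof (pos_INR k); lra).
    simpl. ring.
Qed.

Lemma Gamma_fact (k : nat) : Gamma (INR k + 1) = INR (fact k).
Proof. rewrite Rplus_comm, Gamma_rfact, Gamma_1, rfact_1 by lra. ring. Qed.

(** * Improper integrals *)

Lemma improper_intP (f : R -> R) (a b l : R) :
  improper_int f a b l <->
  (forall eps, eps > 0 -> exists delta, delta > 0 /\
     forall u v, a < u -> u < a + delta -> b - delta < v -> v < b ->
       exists I, is_RInt f u v I /\ Rabs (I - l) < eps).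
Proof.
  split; intros H eps He; destruct (H eps He) as [d [Hd HH]]; exists d; split; try exact Hd;
    intros u v H1 H2 H3 H4.
  - destruct (HH u v H1 H2 H3 H4) as [pr Hpr].
    exists (RiemannInt pr). split; [|exact Hpr].
    rewrite <- (RInt_Reals f u v pr). apply (@RInt_correct R_CompleteNormedModule).
    now apply ex_RInt_Reals_1.
  - destruct (HH u v H1 H2 H3 H4) as [I [HI HI2]].
    assert (pr : Riemann_integrable f u v) by (apply ex_RInt_Reals_0; now exists I).
    exists pr. rewrite <- (RInt_Reals f u v pr), (is_RInt_unique f u v I HI). exact HI2.
Qed.

Lemma improper_int_ext (f g : R -> R) (a b l : R) : a < b ->
  (forall t, a < t < b -> f t = g t) -> improper_int f a b l -> improper_int g a b l.
Proof.
  intros Hab Hfg Hf. apply improper_intP. intros eps He.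
  destruct (proj1 (improper_intP f a b l) Hf eps He) as [d [Hd H]].
  exists (Rmin d (b - a)).
  pose proof (Rmin_l d (b - a)). pose proof (Rmin_r d (b - a)).
  split; [apply Rmin_glb_lt; lra|]. intros u v Hu1 Hu2 Hv1 Hv2.
  destruct (H u v) as [I [HI HI2]]; try lra.
  exists I. split; [|exact HI2].
  apply (is_RInt_ext f); [|exact HI].
  intros t Ht. apply Hfg.
  assert (a < Rmin u v) by (apply Rmin_glb_lt; lra).
  assert (Rmax u v < b) by (apply Rmax_lub_lt; lra). lra.
Qed.

Lemma improper_int_lin (f g : R -> R) (a b c d l m : R) :
  improper_int f a b l -> improper_int g a b m ->
  improper_int (fun t => c * f t + d * g t) a b (c * l + d * m).
Proof.
  intros Hf Hg. apply improper_intP. intros eps He.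
  (* The extra [1] keeps [K] positive and makes the final bound strict. *)
  set (K := Rabs c + Rabs d + 1).
  pose proof (Rabs_pos c). pose proof (Rabs_pos d).
  assert (HK : eps / K > 0) by (apply Rdiv_lt_0_compat; unfold K; lra).
  destruct (proj1 (improper_intP f a b l) Hf _ HK) as [d1 [Hd1 H1]].
  destruct (proj1 (improper_intP g a b m) Hg _ HK) as [d2 [Hd2 H2]].
  exists (Rmin d1 d2).
  pose proof (Rmin_l d1 d2). pose proof (Rmin_r d1 d2).
  split; [now apply Rmin_glb_lt|]. intros u v Hu1 Hu2 Hv1 Hv2.
  destruct (H1 u v) as [I [HI HI2]]; try lra.
  destruct (H2 u v) as [J [HJ HJ2]]; try lra.
  exists (c * I + d * J). split.
  - apply (is_RInt_plus (V := R_NormedModule) (fun t => c * f t) (fun t => d * g t)).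
    + now apply (is_RInt_scal (V := R_NormedModule) f).
    + now apply (is_RInt_scal (V := R_NormedModule) g).
  - replace (c * I + d * J - (c * l + d * m)) with (c * (I - l) + d * (J - m)) by ring.
    eapply Rle_lt_trans; [apply Rabs_triang|]. rewrite !Rabs_mult.
    apply Rle_lt_trans with (Rabs c * (eps / K) + Rabs d * (eps / K)).
    + apply Rplus_le_compat; apply Rmult_le_compat_l; lra.
    + replace (Rabs c * (eps / K) + Rabs d * (eps / K)) with ((K - 1) * (eps / K))
        by (unfold K; ring).
      replace eps with (K * (eps / K)) at 2 by (field; unfold K; lra).
      apply Rmult_lt_compat_r; lra.
Qed.

Lemma improper_int_le (f g : R -> R) (a b l m : R) : a < b ->
  (forall t, a < t < b -> f t <= g t) ->
  improper_int f a b l -> improper_int g a b m -> l <= m.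
Proof.
  intros Hab Hfg Hf Hg. apply Rnot_lt_le. intros Hlt.
  assert (He : (l - m) / 2 > 0) by lra.
  destruct (proj1 (improper_intP f a b l) Hf _ He) as [d1 [Hd1 H1]].
  destruct (proj1 (improper_intP g a b m) Hg _ He) as [d2 [Hd2 H2]].
  (* The bound [(b - a) / 2] keeps the two cut-off points in order. *)
  set (d := Rmin (Rmin d1 d2) ((b - a) / 2)).
  assert (Hd : 0 < d) by (unfold d; repeat apply Rmin_glb_lt; lra).
  assert (d <= d1 /\ d <= d2 /\ d <= (b - a) / 2) as [Hda [Hdb Hdc]].
  { unfold d. pose proof (Rmin_l (Rmin d1 d2) ((b - a) / 2)).
    pose proof (Rmin_r (Rmin d1 d2) ((b - a) / 2)).
    pose proof (Rmin_l d1 d2). pose proof (Rmin_r d1 d2). lra. }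
  destruct (H1 (a + d / 2) (b - d / 2)) as [I [HI HI2]]; try lra.
  destruct (H2 (a + d / 2) (b - d / 2)) as [J [HJ HJ2]]; try lra.
  assert (I <= J).
  { apply (is_RInt_le f g (a + d / 2) (b - d / 2)); try lra; try assumption.
    intros t Ht. apply Hfg. lra. }
  apply Rabs_def2 in HI2. apply Rabs_def2 in HJ2. lra.
Qed.

Lemma improper_int_unique (f : R -> R) (a b l m : R) : a < b ->
  improper_int f a b l -> improper_int f a b m -> l = m.
Proof.
  intros Hab Hl Hm. apply Rle_antisym.
  - apply (improper_int_le f f a b); auto; intros; lra.
  - apply (improper_int_le f f a b); auto; intros; lra.
Qed.

Lemma IInt_eq (f : R -> R) (a b l : R) : a < b -> improper_int f a b l -> IInt f a b = l.
Proof.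
  intros Hab Hl. apply (improper_int_unique f a b); auto.
  unfold IInt. apply epsilon_spec. now exists l.
Qed.

(** The boundary values are limits from inside: [Rpower 0 a] is [1], because [ln 0] has the default
    value [0], so a power that tends to [0] at an end point does not have the value [0] there. *)
Lemma improper_int_derive (F f : R -> R) (a b la lb : R) : a < b ->
  (forall t, a < t < b -> is_derive F t (f t)) ->
  (forall t, a < t < b -> continuous f t) ->
  (forall eps, eps > 0 -> exists d, d > 0 /\
     forall t, a < t < b -> t < a + d -> Rabs (F t - la) < eps) ->
  (forall eps, eps > 0 -> exists d, d > 0 /\
     forall t, a < t < b -> b - d < t -> Rabs (F t - lb) < eps) ->
  improper_int f a b (lb - la).
Proof.
  intros Hab HF Hf Ha Hb. apply improper_intP. intros eps He.
  assert (He2 : eps / 2 > 0) by lra.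
  destruct (Ha _ He2) as [d1 [Hd1 H1]]. destruct (Hb _ He2) as [d2 [Hd2 H2]].
  set (d := Rmin (Rmin d1 d2) (b - a)).
  assert (Hd : 0 < d) by (unfold d; repeat apply Rmin_glb_lt; lra).
  assert (d <= d1 /\ d <= d2 /\ d <= b - a) as [Hda [Hdb Hdc]].
  { unfold d. pose proof (Rmin_l (Rmin d1 d2) (b - a)).
    pose proof (Rmin_r (Rmin d1 d2) (b - a)).
    pose proof (Rmin_l d1 d2). pose proof (Rmin_r d1 d2). lra. }
  exists d. split; [exact Hd|]. intros u v Hu1 Hu2 Hv1 Hv2.
  exists (F v - F u). split.
  - assert (a < Rmin u v) by (apply Rmin_glb_lt; lra).
    assert (Rmax u v < b) by (apply Rmax_lub_lt; lra).
    apply (is_RInt_derive (V := R_CompleteNormedModule) F f).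
    + intros t Ht. apply HF. lra.
    + intros t Ht. apply Hf. lra.
  - pose proof (H1 u ltac:(lra) ltac:(lra)) as K1. pose proof (H2 v ltac:(lra) ltac:(lra)) as K2.
    apply Rabs_def2 in K1. apply Rabs_def2 in K2. apply Rabs_def1; lra.
Qed.

(** For a nonnegative integrand the integral grows with the interval, so the limit is the supremum
    over compact subintervals. *)
Lemma improper_int_bounded (f : R -> R) (a b M : R) : a < b ->
  (forall t, a < t < b -> continuous f t) ->
  (forall t, a < t < b -> 0 <= f t) ->
  (forall u v, a < u -> u <= v -> v < b -> Coquelicot.RInt.RInt f u v <= M) ->
  exists l, improper_int f a b l.
Proof.
  intros Hab Hf Hpos HM.
  assert (Hex : forall u v, a < u < b -> a < v < b -> ex_RInt f u v).
  { intros u v Hu Hv. apply (ex_RInt_continuous (V := R_CompleteNormedModule)).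
    intros z Hz. apply Hf.
    assert (a < Rmin u v) by (apply Rmin_glb_lt; lra).
    assert (Rmax u v < b) by (apply Rmax_lub_lt; lra). lra. }
  assert (H0 : forall u v, a < u -> u <= v -> v < b -> 0 <= Coquelicot.RInt.RInt f u v).
  { intros u v H1 H2 H3. apply RInt_ge_0; [exact H2 | apply Hex; lra |].
    intros t Ht. apply Hpos. lra. }
  set (E := fun y => exists u v, a < u /\ u <= v /\ v < b /\ y = Coquelicot.RInt.RInt f u v).
  destruct (completeness E) as [l [Hub Hlub]].
  { exists M. intros y [u [v [H1 [H2 [H3 ->]]]]]. now apply HM. }
  { exists (Coquelicot.RInt.RInt f ((a + b) / 2) ((a + b) / 2)), ((a + b) / 2), ((a + b) / 2).
    repeat split; lra. }
  exists l. apply improper_intP. intros eps He.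
  assert (Hc : exists u0 v0, a < u0 /\ u0 <= v0 /\ v0 < b /\
                 l - eps < Coquelicot.RInt.RInt f u0 v0).
  { apply NNPP. intros Hn. assert (l <= l - eps); [|lra].
    apply Hlub. intros y [u [v [H1 [H2 [H3 ->]]]]].
    apply Rnot_lt_le. intros Hlt. apply Hn. exists u, v. auto. }
  destruct Hc as [u0 [v0 [H1 [H2 [H3 H4]]]]].
  (* This margin forces [[u, v]] to contain the near-optimal interval [[u0, v0]]. *)
  exists (Rmin (u0 - a) (b - v0)).
  pose proof (Rmin_l (u0 - a) (b - v0)). pose proof (Rmin_r (u0 - a) (b - v0)).
  split; [apply Rmin_glb_lt; lra|]. intros u v Hu1 Hu2 Hv1 Hv2.
  exists (Coquelicot.RInt.RInt f u v). split.
  { apply (@RInt_correct R_CompleteNormedModule). apply Hex; lra. }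
  assert (Hle : Coquelicot.RInt.RInt f u v <= l).
  { apply Hub. exists u, v. repeat split; lra. }
  assert (Hch : Coquelicot.RInt.RInt f u v = Coquelicot.RInt.RInt f u u0
            + Coquelicot.RInt.RInt f u0 v0 + Coquelicot.RInt.RInt f v0 v).
  { rewrite <- (RInt_Chasles f u u0 v), <- (RInt_Chasles f u0 v0 v); try (apply Hex; lra).
    unfold plus; simpl. ring. }
  pose proof (H0 u u0 ltac:(lra) ltac:(lra) ltac:(lra)).
  pose proof (H0 v0 v ltac:(lra) ltac:(lra) ltac:(lra)).
  apply Rabs_def1; lra.
Qed.

(** * The Beta integral *)

(** Free end points let one integral serve both the Jacobi weight on [(-1, 1)] and the
    Riemann-Liouville kernel on [(-1, x)]. *)
Definition beta_kernel (A B a b t : R) : R := Rpower (B - t) (a - 1) * Rpower (t - A) (b - 1).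

Lemma is_derive_Rpower (a t : R) : 0 < t ->
  is_derive (fun s => Rpower s a) t (a * Rpower t (a - 1)).
Proof. intros Ht. apply is_derive_Reals. now apply derivable_pt_lim_power. Qed.

Lemma is_derive_Rpower_r (B a t : R) : t < B ->
  is_derive (fun s => Rpower (B - s) a) t (- (a * Rpower (B - t) (a - 1))).
Proof.
  intros Ht.
  replace (- (a * Rpower (B - t) (a - 1))) with (scal (-1) (a * Rpower (B - t) (a - 1)))
    by (unfold scal; simpl; unfold mult; simpl; ring).
  apply (is_derive_comp (fun s => Rpower s a) (fun s => B - s)).
  - apply is_derive_Rpower. lra.
  - auto_derive; [exact I | ring].
Qed.

Lemma is_derive_Rpower_l (A a t : R) : A < t ->
  is_derive (fun s => Rpower (s - A) a) t (a * Rpower (t - A) (a - 1)).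
Proof.
  intros Ht.
  replace (a * Rpower (t - A) (a - 1)) with (scal 1 (a * Rpower (t - A) (a - 1)))
    by (unfold scal; simpl; unfold mult; simpl; ring).
  apply (is_derive_comp (fun s => Rpower s a) (fun s => s - A)).
  - apply is_derive_Rpower. lra.
  - auto_derive; [exact I | ring].
Qed.

Lemma continuous_Rpower_r (B a t : R) : t < B -> continuous (fun s => Rpower (B - s) a) t.
Proof.
  intros Ht. apply (ex_derive_continuous (V := R_NormedModule)).
  eexists. now apply is_derive_Rpower_r.
Qed.

Lemma continuous_Rpower_l (A a t : R) : A < t -> continuous (fun s => Rpower (s - A) a) t.
Proof.
  intros Ht. apply (ex_derive_continuous (V := R_NormedModule)).
  eexists. now apply is_derive_Rpower_l.
Qed.

Lemma continuous_beta_kernel (A B a b t : R) : A < t < B -> continuous (beta_kernel A B a b) t.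
Proof.
  intros Ht. apply (continuous_mult (K := R_AbsRing)
    (fun s => Rpower (B - s) (a - 1)) (fun s => Rpower (s - A) (b - 1))).
  - apply continuous_Rpower_r. lra.
  - apply continuous_Rpower_l. lra.
Qed.

Lemma Rpower_small (a K eps : R) : 0 < a -> 0 < K -> 0 < eps ->
  exists d, d > 0 /\ forall y, 0 < y < d -> K * Rpower y a < eps.
Proof.
  intros Ha HK He. exists (Rpower (eps / K) (/ a)). split; [apply Rpower_pos|].
  intros y Hy. apply Rlt_le_trans with (K * Rpower (Rpower (eps / K) (/ a)) a).
  - apply Rmult_lt_compat_l; [assumption|]. now apply Rlt_Rpower_l.
  - rewrite Rpower_mult, Rinv_l, Rpower_1 by
      (try (apply Rdiv_lt_0_compat; lra); lra).
    right. field. lra.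
Qed.

(** The power is monotone, in a direction that depends on the sign of [e]; the sum of both end
    values spares later proofs that distinction. *)
Lemma Rpower_le_ends (e p q y : R) : 0 < p -> p <= y <= q ->
  Rpower y e <= Rpower p e + Rpower q e.
Proof.
  intros Hp Hy. destruct (Rle_lt_dec 0 e) as [He|He].
  - assert (Rpower y e <= Rpower q e) by (apply Rle_Rpower_l; lra). pose proof (Rpower_pos p e). lra.
  - assert (Rpower y e <= Rpower p e).
    { replace e with (- - e) by ring. rewrite !(Rpower_Ropp _ (- e)).
      apply Rinv_le_contravar; [apply Rpower_pos|]. apply Rle_Rpower_l; lra. }
    pose proof (Rpower_pos q e). lra.
Qed.

(** On each half of the interval one factor is bounded, by [K1] or by [K2]. The kernel is thus
    dominated by a sum of two one-sided powers, whose antiderivative [G] is explicit and bounded. *)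
Lemma beta_ex (A B a b : R) : A < B -> 0 < a -> 0 < b ->
  exists l, improper_int (beta_kernel A B a b) A B l.
Proof.
  intros HAB Ha Hb.
  set (h := (B - A) / 2).
  set (K1 := Rpower h (a - 1) + Rpower (B - A) (a - 1)).
  set (K2 := Rpower h (b - 1) + Rpower (B - A) (b - 1)).
  assert (HK1 : 0 < K1) by (unfold K1; pose proof (Rpower_pos h (a - 1)); pose proof (Rpower_pos (B - A) (a - 1)); lra).
  assert (HK2 : 0 < K2) by (unfold K2; pose proof (Rpower_pos h (b - 1)); pose proof (Rpower_pos (B - A) (b - 1)); lra).
  set (g := fun t => K2 / a * (a * Rpower (B - t) (a - 1)) + K1 / b * (b * Rpower (t - A) (b - 1))).
  set (G := fun t => K2 / a * - Rpower (B - t) a + K1 / b * Rpower (t - A) b).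
  assert (HG : forall t, A < t < B -> is_derive G t (g t)).
  { intros t Ht. unfold G, g.
    apply (is_derive_plus (V := R_NormedModule) (fun t => K2 / a * - Rpower (B - t) a)).
    - apply (is_derive_scal (fun t => - Rpower (B - t) a)).
      rewrite <- (Ropp_involutive (a * _)).
      apply (is_derive_opp (V := R_NormedModule)). apply is_derive_Rpower_r. lra.
    - apply (is_derive_scal (fun t => Rpower (t - A) b)). apply is_derive_Rpower_l. lra. }
  assert (Hgc : forall t, A < t < B -> continuous g t).
  { intros t Ht. unfold g.
    apply (continuous_plus (V := R_NormedModule)).
    - apply (continuous_scal_r (V := R_NormedModule) (K2 / a)).
      apply (continuous_scal_r (V := R_NormedModule) a). apply continuous_Rpower_r. lra.
    - apply (continuous_scal_r (V := R_NormedModule) (K1 / b)).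
      apply (continuous_scal_r (V := R_NormedModule) b). apply continuous_Rpower_l. lra. }
  apply (improper_int_bounded _ A B (K2 / a * Rpower (B - A) a + K1 / b * Rpower (B - A) b)).
  - exact HAB.
  - intros t Ht. now apply continuous_beta_kernel.
  - intros t Ht. left. apply Rmult_lt_0_compat; apply Rpower_pos.
  - intros u v Hu Huv Hv.
    assert (HgI : is_RInt g u v (G v - G u)).
    { apply (is_RInt_derive (V := R_CompleteNormedModule) G g); intros t Ht;
        rewrite Rmin_left, Rmax_right in Ht by lra; [apply HG | apply Hgc]; lra. }
    apply Rle_trans with (G v - G u).
    + rewrite <- (is_RInt_unique _ _ _ _ HgI). apply RInt_le; [lra | | eexists; exact HgI |].
      * apply (ex_RInt_continuous (V := R_CompleteNormedModule)). intros t Ht.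
        rewrite Rmin_left, Rmax_right in Ht by lra. apply continuous_beta_kernel. lra.
      * intros t Ht. unfold g, beta_kernel.
        replace (K2 / a * (a * Rpower (B - t) (a - 1))) with (Rpower (B - t) (a - 1) * K2) by (field; lra).
        replace (K1 / b * (b * Rpower (t - A) (b - 1))) with (K1 * Rpower (t - A) (b - 1)) by (field; lra).
        pose proof (Rpower_pos (B - t) (a - 1)) as P1. pose proof (Rpower_pos (t - A) (b - 1)) as P2.
        destruct (Rle_lt_dec (t - A) h) as [Hm|Hm].
        -- assert (Hk : Rpower (B - t) (a - 1) <= K1) by (apply Rpower_le_ends; unfold h in *; lra).
           pose proof (Rmult_le_compat_r _ _ _ (Rlt_le _ _ P2) Hk).
           pose proof (Rmult_lt_0_compat _ _ P1 HK2). lra.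
        -- assert (Hk : Rpower (t - A) (b - 1) <= K2) by (apply Rpower_le_ends; unfold h in *; lra).
           pose proof (Rmult_le_compat_l _ _ _ (Rlt_le _ _ P1) Hk).
           pose proof (Rmult_lt_0_compat _ _ HK1 P2). lra.
    + unfold G.
      assert (Q1 : 0 < K2 / a) by (apply Rdiv_lt_0_compat; lra).
      assert (Q2 : 0 < K1 / b) by (apply Rdiv_lt_0_compat; lra).
      assert (R1 : Rpower (B - u) a <= Rpower (B - A) a) by (apply Rle_Rpower_l; lra).
      assert (R2 : Rpower (v - A) b <= Rpower (B - A) b) by (apply Rle_Rpower_l; lra).
      pose proof (Rmult_le_compat_l _ _ _ (Rlt_le _ _ Q1) R1).
      pose proof (Rmult_le_compat_l _ _ _ (Rlt_le _ _ Q2) R2).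
      pose proof (Rmult_lt_0_compat _ _ Q1 (Rpower_pos (B - v) a)).
      pose proof (Rmult_lt_0_compat _ _ Q2 (Rpower_pos (u - A) b)).
      lra.
Qed.

Lemma Rpower_pred (y a : R) : 0 < y -> Rpower y a = Rpower y (a - 1) * y.
Proof.
  intros Hy. rewrite <- (Rpower_1 y) at 3 by assumption. rewrite <- Rpower_plus. f_equal. ring.
Qed.

(* Integrating the derivative of [(B - t)^a (t - A)^b], whose boundary values vanish. *)
Lemma beta_step (A B a b l : R) : A < B -> 0 < a -> 0 < b ->
  improper_int (beta_kernel A B a b) A B l ->
  improper_int (beta_kernel A B a (b + 1)) A B (b / (a + b) * (B - A) * l).
Proof.
  intros HAB Ha Hb Hl.
  set (F := fun t => Rpower (B - t) a * Rpower (t - A) b).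
  set (f := fun t => - (a * Rpower (B - t) (a - 1)) * Rpower (t - A) b
                     + Rpower (B - t) a * (b * Rpower (t - A) (b - 1))).
  assert (HF : improper_int f A B (0 - 0)).
  { apply (improper_int_derive F); [exact HAB | | | |].
    - intros t Ht. unfold F, f.
      apply (is_derive_mult (fun t => Rpower (B - t) a) (fun t => Rpower (t - A) b)).
      + apply is_derive_Rpower_r. lra.
      + apply is_derive_Rpower_l. lra.
      + intros; apply Rmult_comm.
    - intros t Ht. unfold f.
      apply (continuous_plus (V := R_NormedModule)).
      + apply (continuous_mult (K := R_AbsRing)
          (fun t => - (a * Rpower (B - t) (a - 1))) (fun t => Rpower (t - A) b));
          [|apply continuous_Rpower_l; lra].
        apply (continuous_opp (V := R_NormedModule)).
        apply (continuous_scal_r (V := R_NormedModule) a). apply continuous_Rpower_r. lra.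
      + apply (continuous_mult (K := R_AbsRing)
          (fun t => Rpower (B - t) a) (fun t => b * Rpower (t - A) (b - 1)));
          [apply continuous_Rpower_r; lra|].
        apply (continuous_scal_r (V := R_NormedModule) b). apply continuous_Rpower_l. lra.
    - intros eps He.
      destruct (Rpower_small b (Rpower (B - A) a) eps Hb (Rpower_pos _ _) He) as [d [Hd H]].
      exists d. split; [exact Hd|]. intros t Ht Htd. unfold F.
      rewrite Rminus_0_r, Rabs_pos_eq by
        (apply Rmult_le_pos; left; apply Rpower_pos).
      eapply Rle_lt_trans; [|apply (H (t - A)); lra].
      apply Rmult_le_compat_r; [left; apply Rpower_pos|]. apply Rle_Rpower_l; lra.
    - intros eps He.
      destruct (Rpower_small a (Rpower (B - A) b) eps Ha (Rpower_pos _ _) He) as [d [Hd H]].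
      exists d. split; [exact Hd|]. intros t Ht Htd. unfold F.
      rewrite Rminus_0_r, Rabs_pos_eq by
        (apply Rmult_le_pos; left; apply Rpower_pos).
      eapply Rle_lt_trans; [|apply (H (B - t)); lra]. rewrite Rmult_comm.
      apply Rmult_le_compat_r; [left; apply Rpower_pos|]. apply Rle_Rpower_l; lra. }
  (* Writing [B - A = (B - t) + (t - A)] shows that [b (B - A)] times the old kernel minus the
     derivative [f] is [a + b] times the new kernel. *)
  pose proof (improper_int_lin _ _ A B (b / (a + b) * (B - A)) (- / (a + b)) _ _ Hl HF) as H.
  replace (b / (a + b) * (B - A) * l) with
    (b / (a + b) * (B - A) * l + - / (a + b) * (0 - 0)) by ring.
  revert H. apply improper_int_ext; [exact HAB|].
  intros t Ht. unfold beta_kernel, f.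
  rewrite (Rpower_pred (B - t) a), (Rpower_pred (t - A) b) by lra.
  replace (b + 1 - 1) with b by ring. rewrite (Rpower_pred (t - A) b) by lra.
  field. lra.
Qed.

Lemma beta_one (A B a : R) : A < B -> 0 < a ->
  improper_int (beta_kernel A B a 1) A B (Rpower (B - A) a / a).
Proof.
  intros HAB Ha.
  apply (improper_int_ext (fun t => / a * (a * Rpower (B - t) (a - 1)))); [exact HAB | |].
  { intros t Ht. unfold beta_kernel. rewrite Rminus_diag, Rpower_O by lra. field. lra. }
  replace (Rpower (B - A) a / a) with (0 - - (Rpower (B - A) a / a)) by ring.
  apply (improper_int_derive (fun t => / a * - Rpower (B - t) a)); [exact HAB | | | |].
  - intros t Ht. apply (is_derive_scal (fun t => - Rpower (B - t) a)).
    rewrite <- (Ropp_involutive (a * _)).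
    apply (is_derive_opp (V := R_NormedModule)). apply is_derive_Rpower_r. lra.
  - intros t Ht. apply (continuous_scal_r (V := R_NormedModule) (/ a)).
    apply (continuous_scal_r (V := R_NormedModule) a). apply continuous_Rpower_r. lra.
  - intros eps He.
    (* At [A] the base [B - t] stays away from [0], so ordinary continuity yields the limit; at [B]
       the smallness of the power is used instead. *)
    assert (Hc : continuity_pt (fun t => / a * - Rpower (B - t) a) A).
    { apply continuity_pt_filterlim. change (continuous (fun t => / a * - Rpower (B - t) a) A).
      apply (continuous_scal_r (V := R_NormedModule) (/ a)).
      apply (continuous_opp (V := R_NormedModule)). now apply continuous_Rpower_r. }
    destruct (Hc eps He) as [d [Hd H]]. exists d. split; [exact Hd|].
    intros t Ht Htd.
    replace (- (Rpower (B - A) a / a)) with (/ a * - Rpower (B - A) a) by (field; lra).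
    apply H. split; [split; [exact I | lra]|].
    simpl. unfold Rdist. rewrite Rabs_pos_eq; lra.
  - intros eps He.
    destruct (Rpower_small a (/ a) eps Ha (Rinv_0_lt_compat _ Ha) He) as [d [Hd H]].
    exists d. split; [exact Hd|]. intros t Ht Htd.
    pose proof (Rmult_lt_0_compat _ _ (Rinv_0_lt_compat _ Ha) (Rpower_pos (B - t) a)).
    replace (/ a * - Rpower (B - t) a - 0) with (- (/ a * Rpower (B - t) a)) by ring.
    rewrite Rabs_Ropp, Rabs_pos_eq by lra. apply H. lra.
Qed.

Lemma beta_iter (A B a b l : R) (n : nat) : A < B -> 0 < a -> 0 < b ->
  improper_int (beta_kernel A B a b) A B l ->
  improper_int (beta_kernel A B a (b + INR n)) A B
    (l * (B - A) ^ n * rfact b n / rfact (a + b) n).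
Proof.
  intros HAB Ha Hb Hl. induction n as [|n IH].
  - simpl. rewrite Rplus_0_r. replace (l * 1 * 1 / 1) with l by field. exact Hl.
  - pose proof (pos_INR n). pose proof (rfact_pos (a + b) n ltac:(lra)).
    rewrite S_INR, <- Rplus_assoc.
    replace (l * (B - A) ^ S n * rfact b (S n) / rfact (a + b) (S n))
      with ((b + INR n) / (a + (b + INR n)) * (B - A) *
            (l * (B - A) ^ n * rfact b n / rfact (a + b) n)) by (simpl; field; lra).
    apply beta_step; try assumption. lra.
Qed.

(** After division by [(B - A)^b] the integrand contains a power of [(t - A)/(B - A)], a base below
    [1], so it decreases in the exponent. *)
Lemma beta_normalized_decr (A B a b1 b2 l1 l2 : R) : A < B -> b1 <= b2 ->
  improper_int (beta_kernel A B a b1) A B l1 ->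
  improper_int (beta_kernel A B a b2) A B l2 ->
  l2 * Rpower (B - A) (b1 - b2) <= l1.
Proof.
  intros HAB Hb H1 H2.
  apply (improper_int_le (fun t => Rpower (B - A) (b1 - b2) * beta_kernel A B a b2 t
                                   + 0 * beta_kernel A B a b1 t)
           (beta_kernel A B a b1) A B); [exact HAB | | | exact H1].
  - intros t Ht. rewrite Rmult_0_l, Rplus_0_r. unfold beta_kernel.
    replace (b2 - 1) with ((b1 - 1) + (b2 - b1)) by ring. rewrite Rpower_plus.
    replace (b1 - b2) with (- (b2 - b1)) by ring. rewrite Rpower_Ropp.
    assert (Hle : Rpower (t - A) (b2 - b1) <= Rpower (B - A) (b2 - b1)) by (apply Rle_Rpower_l; lra).
    pose proof (Rpower_pos (B - A) (b2 - b1)) as HP.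
    pose proof (Rmult_lt_0_compat _ _ (Rpower_pos (B - t) (a - 1)) (Rpower_pos (t - A) (b1 - 1))) as HQ.
    apply Rmult_le_reg_l with (Rpower (B - A) (b2 - b1)); [exact HP|].
    replace (Rpower (B - A) (b2 - b1) * (/ Rpower (B - A) (b2 - b1) *
      (Rpower (B - t) (a - 1) * (Rpower (t - A) (b1 - 1) * Rpower (t - A) (b2 - b1)))))
      with ((Rpower (B - t) (a - 1) * Rpower (t - A) (b1 - 1)) * Rpower (t - A) (b2 - b1))
      by (field; lra).
    rewrite (Rmult_comm (Rpower (B - A) _)). apply Rmult_le_compat_l; lra.
  - replace (l2 * Rpower (B - A) (b1 - b2))
      with (Rpower (B - A) (b1 - b2) * l2 + 0 * l1) by ring.
    now apply improper_int_lin.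
Qed.

(* [n^a] times the normalized integral at [n + b] is squeezed between its values
   at [n + 1] and [n], which are Gauss products. *)
Lemma beta_Gamma_le1 (A B a b l : R) : A < B -> 0 < a -> 0 < b <= 1 ->
  improper_int (beta_kernel A B a b) A B l ->
  l * Gamma (a + b) = Rpower (B - A) (a + b - 1) * (Gamma a * Gamma b).
Proof.
  intros HAB Ha Hb Hl.
  set (D := B - A). assert (HD : 0 < D) by (unfold D; lra).
  set (W := Rpower D (a + b - 1)). assert (HW : 0 < W) by apply Rpower_pos.
  assert (HDa : Rpower D a * Rpower D b = W * D).
  { unfold W. rewrite <- Rpower_plus. apply Rpower_pred. exact HD. }
  assert (Hlow : forall p, W * (INR (fact p) / rfact a (S p)) <= l * rfact b p / rfact (a + b) p).
  { intros p.
    pose proof (beta_iter A B a b l p HAB Ha (proj1 Hb) Hl) as H1.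
    pose proof (beta_iter A B a 1 _ p HAB Ha ltac:(lra) (beta_one A B a HAB Ha)) as H2.
    pose proof (beta_normalized_decr A B a (b + INR p) (1 + INR p) _ _ HAB ltac:(lra) H1 H2) as H.
    fold D in H. replace (b + INR p - (1 + INR p)) with (b - 1) in H by ring.
    rewrite rfact_1 in H. rewrite rfact_S_l.
    assert (HDp : 0 < D ^ p) by (now apply pow_lt).
    pose proof (rfact_pos (a + 1) p ltac:(lra)). pose proof (rfact_pos (a + b) p ltac:(lra)).
    apply Rmult_le_reg_r with (D ^ p); [exact HDp|].
    assert (HWE : Rpower D a * Rpower D (b - 1) = W).
    { unfold W. rewrite <- Rpower_plus. f_equal. ring. }
    rewrite <- HWE.
    eapply Rle_trans; [|eapply Rle_trans; [exact H|]]; right; field; lra. }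
  assert (Hup : forall n, l * rfact b (S n) / rfact (a + b) (S n) <= W * (INR (fact n) / rfact a (S n))).
  { intros n.
    pose proof (beta_iter A B a b l (S n) HAB Ha (proj1 Hb) Hl) as H1.
    pose proof (beta_iter A B a 1 _ n HAB Ha ltac:(lra) (beta_one A B a HAB Ha)) as H2.
    assert (Hle : 1 + INR n <= b + INR (S n)) by (rewrite S_INR; lra).
    pose proof (beta_normalized_decr A B a (1 + INR n) (b + INR (S n)) _ _ HAB Hle H2 H1) as H.
    fold D in H. replace (1 + INR n - (b + INR (S n))) with (- b) in H by (rewrite S_INR; ring).
    rewrite Rpower_Ropp, rfact_1 in H. rewrite (rfact_S_l a).
    assert (HDp : 0 < D ^ n) by (now apply pow_lt).
    pose proof (rfact_pos (a + 1) n ltac:(lra)). pose proof (rfact_pos (a + b) (S n) ltac:(lra)).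
    pose proof (Rpower_pos D b) as HDb.
    change (D ^ S n) with (D * D ^ n) in H.
    apply Rmult_le_reg_r with (D ^ n * D * / Rpower D b).
    { apply Rmult_lt_0_compat; [apply Rmult_lt_0_compat; assumption | now apply Rinv_0_lt_compat]. }
    eapply Rle_trans; [|eapply Rle_trans; [exact H|]]; [right; field; lra|].
    right. replace (W * (INR (fact n) / (a * rfact (a + 1) n)) * (D ^ n * D * / Rpower D b))
      with ((W * D) * (INR (fact n) / (a * rfact (a + 1) n)) * (D ^ n * / Rpower D b)) by ring.
    rewrite <- HDa. field. lra. }
  (* These factors tend to [1] and absorb the index shifts between the two bounds and Gauss'
     sequences. *)
  set (Rt := fun c n => INR (S n) / (INR (S n) + c)).
  assert (HRt : forall c, 0 <= c -> Un_cv (Rt c) 1) by (intros; now apply ratio_cv).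
  pose proof (Gamma_cv a Ha) as Ga. pose proof (Gamma_cv b (proj1 Hb)) as Gb.
  assert (Gab : Un_cv (gauss_seq (a + b)) (Gamma (a + b))) by (apply Gamma_cv; lra).
  assert (Hc1 : Un_cv (fun n => W * (gauss_seq a n * gauss_seq b n) * Rt (a + b) n)
                  (W * (Gamma a * Gamma b) * 1)).
  { apply CV_mult; [|apply HRt; lra].
    apply (CV_mult (fun _ => W)); [apply Un_cv_const|]. now apply CV_mult. }
  assert (Hc2 : Un_cv (fun n => l * gauss_seq (a + b) n * Rt b n) (l * Gamma (a + b) * 1)).
  { apply CV_mult; [|apply HRt; lra].
    apply (CV_mult (fun _ => l)); [apply Un_cv_const | assumption]. }
  assert (Hc3 : Un_cv (fun n => l * gauss_seq (a + b) n * Rt b n * Rt a n) (l * Gamma (a + b) * 1 * 1)).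
  { apply CV_mult; [exact Hc2|]. apply HRt; lra. }
  rewrite !Rmult_1_r in *.
  apply Rle_antisym.
  - eapply Rle_cv_lim; [|exact Hc3|exact Hc1].
    intros n. pose proof (Hup n) as H. unfold Rt. rewrite !gauss_seqE.
    set (p := INR (S n)) in *. assert (Hp : 0 < p) by (apply lt_0_INR; lia).
    rewrite (Rpower_plus a b). rewrite (fact_simpl n), mult_INR. fold p.
    change (rfact a (S (S n))) with (rfact a (S n) * (a + p)).
    change (rfact b (S (S n))) with (rfact b (S n) * (b + p)).
    change (rfact (a + b) (S (S n))) with (rfact (a + b) (S n) * (a + b + p)).
    pose proof (rfact_pos a (S n) Ha) as R1. pose proof (rfact_pos b (S n) (proj1 Hb)) as R2.
    pose proof (rfact_pos (a + b) (S n) ltac:(lra)) as R3. pose proof (fact_INR_pos n) as R4.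
    pose proof (Rpower_pos p a) as R5. pose proof (Rpower_pos p b) as R6.
    (* [K] is the positive factor that turns [Hup n] into an inequality between Gauss' sequences. *)
    set (K := Rpower p a * Rpower p b * (p * INR (fact n)) * p * p / (rfact b (S n) * (b + p) * (a + p) * (a + b + p))).
    assert (HK : 0 < K).
    { unfold K. apply Rdiv_lt_0_compat; repeat (first [assumption | lra | apply Rmult_lt_0_compat]). }
    apply (Rmult_le_compat_r K) in H; [|lra].
    eapply Rle_trans; [|eapply Rle_trans; [exact H|]]; right; unfold K; field; repeat split; lra.
  - eapply Rle_cv_lim; [|exact Hc1|exact Hc2].
    intros n. pose proof (Hlow (S n)) as H. unfold Rt. rewrite !gauss_seqE.
    set (p := INR (S n)) in *. assert (Hp : 0 < p) by (apply lt_0_INR; lia).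
    rewrite (Rpower_plus a b).
    change (rfact b (S (S n))) with (rfact b (S n) * (b + p)).
    change (rfact (a + b) (S (S n))) with (rfact (a + b) (S n) * (a + b + p)).
    pose proof (rfact_pos a (S (S n)) Ha) as R1. pose proof (rfact_pos b (S n) (proj1 Hb)) as R2.
    pose proof (rfact_pos (a + b) (S n) ltac:(lra)) as R3. pose proof (fact_INR_pos (S n)) as R4.
    pose proof (Rpower_pos p a) as R5. pose proof (Rpower_pos p b) as R6.
    set (K := Rpower p a * Rpower p b * INR (fact (S n)) * p / (rfact b (S n) * (b + p) * (a + b + p))).
    assert (HK : 0 < K).
    { unfold K. apply Rdiv_lt_0_compat; repeat (first [assumption | lra | apply Rmult_lt_0_compat]). }
    apply (Rmult_le_compat_r K) in H; [|lra].
    eapply Rle_trans; [|eapply Rle_trans; [exact H|]]; right; unfold K; field; repeat split; lra.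
Qed.

(** [beta_step] and the functional equation of [Gamma] change both sides alike when [b] grows by
    one, which reduces every [b] to the range [(0, 1]]. *)
Lemma beta_Gamma (A B a b : R) : A < B -> 0 < a -> 0 < b ->
  improper_int (beta_kernel A B a b) A B
    (Rpower (B - A) (a + b - 1) * (Gamma a * Gamma b / Gamma (a + b))).
Proof.
  intros HAB Ha Hb.
  assert (H : forall k b, 0 < b <= INR k + 1 ->
    improper_int (beta_kernel A B a b) A B
      (Rpower (B - A) (a + b - 1) * (Gamma a * Gamma b / Gamma (a + b)))).
  { clear b Hb. induction k as [|k IH]; intros b Hb.
    - simpl in Hb. destruct (beta_ex A B a b HAB Ha (proj1 Hb)) as [l Hl].
      pose proof (beta_Gamma_le1 A B a b l HAB Ha ltac:(lra) Hl) as E.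
      pose proof (Gamma_pos (a + b) ltac:(lra)).
      replace (Rpower (B - A) (a + b - 1) * (Gamma a * Gamma b / Gamma (a + b))) with l; [exact Hl|].
      apply Rmult_eq_reg_r with (Gamma (a + b)); [|lra]. rewrite E. field. lra.
    - destruct (Rle_lt_dec b 1) as [H1|H1].
      + apply IH. pose proof (pos_INR k). lra.
      + rewrite S_INR in Hb. pose proof (IH (b - 1) ltac:(lra)) as H.
        apply beta_step in H; try lra. replace (b - 1 + 1) with b in H by ring.
        replace (Rpower (B - A) (a + b - 1) * (Gamma a * Gamma b / Gamma (a + b)))
          with ((b - 1) / (a + (b - 1)) * (B - A) *
            (Rpower (B - A) (a + (b - 1) - 1) * (Gamma a * Gamma (b - 1) / Gamma (a + (b - 1)))));
          [exact H|].
        pose proof (Gamma_pos (a + (b - 1)) ltac:(lra)).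
        replace (Gamma b) with (Gamma (b - 1 + 1)) by (f_equal; ring).
        replace (Gamma (a + b)) with (Gamma (a + (b - 1) + 1)) by (f_equal; ring).
        rewrite !Gamma_succ by lra. rewrite (Rpower_pred (B - A) (a + b - 1)) by lra.
        replace (a + (b - 1) - 1) with (a + b - 1 - 1) by ring. field. lra. }
  destruct (INR_unbounded b) as [k Hk]. apply (H k). lra.
Qed.

(** * Terminating hypergeometric sums *)

Lemma sum_f_R0_zero (f : nat -> R) (n : nat) :
  (forall k, (k <= n)%nat -> f k = 0) -> sum_f_R0 f n = 0.
Proof.
  intros H. rewrite (sum_eq f (fun _ => 0) n H), sum_cte. ring.
Qed.

Lemma sum_f_R0_single (f : nat -> R) (n i : nat) : (i <= n)%nat ->
  (forall k, (k <= n)%nat -> k <> i -> f k = 0) -> sum_f_R0 f n = f i.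
Proof.
  induction n as [|n IH]; intros Hi H.
  - replace i with 0%nat by lia. reflexivity.
  - simpl. destruct (Nat.eq_dec i (S n)) as [->|Hn].
    + rewrite sum_f_R0_zero; [ring|]. intros k Hk. apply H; lia.
    + rewrite IH, (H (S n)) by (try lia; intros; apply H; lia). ring.
Qed.

(* The binomial coefficient, in the form in which it occurs in the series. *)
Definition binom (n k : nat) : R := (-1) ^ k * rfact (- INR n) k / INR (fact k).

Lemma binom_0 (n : nat) : binom n 0 = 1.
Proof. unfold binom. simpl. field. Qed.

Lemma binom_gt (n k : nat) : (n < k)%nat -> binom n k = 0.
Proof. intros H. unfold binom. rewrite rfact_opp_nat by assumption. unfold Rdiv. ring. Qed.

Lemma binom_diag (n : nat) : binom n n = 1.
Proof.
  unfold binom. pose proof (rfact_opp 0 n) as H.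
  replace (- 0 - INR n) with (- INR n) in H by ring. rewrite H, Rplus_0_l, rfact_1.
  pose proof (fact_INR_pos n).
  replace ((-1) ^ n * ((-1) ^ n * INR (fact n)) / INR (fact n)) with ((-1) ^ n * (-1) ^ n) by (field; lra).
  rewrite <- Rpow_mult_distr. replace (-1 * -1) with 1 by ring. apply pow1.
Qed.

Lemma binom_pascal (n k : nat) : binom (S n) (S k) = binom n (S k) + binom n k.
Proof.
  unfold binom. rewrite rfact_S_l, fact_simpl, mult_INR.
  replace (- INR (S n) + 1) with (- INR n) by (rewrite S_INR; ring).
  pose proof (fact_INR_pos k).
  assert (0 < INR (S k)) by (apply lt_0_INR; lia).
  simpl rfact. simpl pow. rewrite !S_INR in *. field. lra.
Qed.

(** Giving [b] the complementary index [n - m] as a second argument turns Pascal's rule into a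
    recursion in which one of the two indices is raised. *)
Definition bsum (n : nat) (b : nat -> nat -> R) : R :=
  sum_f_R0 (fun m => binom n m * b m (n - m)%nat) n.

Lemma bsum_S (n : nat) (b : nat -> nat -> R) :
  bsum (S n) b = bsum n (fun m j => b m (S j)) + bsum n (fun m j => b (S m) j).
Proof.
  assert (H : bsum n (fun m j => b m (S j)) =
              sum_f_R0 (fun m => binom n m * b m (S n - m)%nat) (S n)).
  { rewrite tech5, binom_gt by lia. rewrite Rmult_0_l, Rplus_0_r.
    apply sum_eq. intros m Hm. now rewrite Nat.sub_succ_l by lia. }
  rewrite H, decomp_sum by lia. unfold bsum. rewrite decomp_sum by lia. simpl pred.
  rewrite !binom_0, Rplus_assoc. f_equal.
  rewrite <- plus_sum. apply sum_eq. intros m Hm. rewrite binom_pascal. simpl. ring.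
Qed.

Lemma bsum_lin (n : nat) (f g : nat -> nat -> R) (u v : R) :
  bsum n (fun m j => u * f m j + v * g m j) = u * bsum n f + v * bsum n g.
Proof.
  unfold bsum. rewrite !scal_sum, <- plus_sum. apply sum_eq. intros m _. ring.
Qed.

Lemma bsum_ext (n : nat) (f g : nat -> nat -> R) :
  (forall m j, (m + j = n)%nat -> f m j = g m j) -> bsum n f = bsum n g.
Proof. intros H. apply sum_eq. intros m Hm. rewrite H by lia. reflexivity. Qed.

Lemma hyp_flip (n : nat) (c d s : R) : 0 < c ->
  rfact c n * bsum n (fun m _ => (-1) ^ m * rfact d m / rfact c m * (1 - s) ^ m) =
  bsum n (fun m j => rfact d m * rfact (c - d) j * s ^ m).
Proof.
  revert c d. induction n as [|n IH]; intros c d Hc.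
  - unfold bsum. simpl. rewrite binom_0. field.
  - rewrite !bsum_S.
    assert (E1 : bsum n (fun m _ => (-1) ^ S m * rfact d (S m) / rfact c (S m) * (1 - s) ^ S m)
      = - (d / c) * (1 - s) *
        bsum n (fun m _ => (-1) ^ m * rfact (d + 1) m / rfact (c + 1) m * (1 - s) ^ m)
        + 0 * bsum n (fun _ _ => 0)).
    { rewrite <- bsum_lin. apply bsum_ext. intros m j _. rewrite !rfact_S_l.
      pose proof (rfact_pos (c + 1) m ltac:(lra)). simpl. field. lra. }
    rewrite E1.
    assert (E2 : rfact c (S n) = rfact c n * (c + INR n)) by reflexivity.
    pose proof (rfact_S_l c n) as E3.
    pose proof (IH c d Hc) as H1. pose proof (IH (c + 1) (d + 1) ltac:(lra)) as H2.
    replace (c + 1 - (d + 1)) with (c - d) in H2 by ring.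
    set (X := bsum n (fun m _ => (-1) ^ m * rfact d m / rfact c m * (1 - s) ^ m)) in *.
    set (Y := bsum n (fun m _ => (-1) ^ m * rfact (d + 1) m / rfact (c + 1) m * (1 - s) ^ m)) in *.
    transitivity ((c + INR n) * (rfact c n * X) + - (d * (1 - s)) * (rfact (c + 1) n * Y)).
    { rewrite Rmult_plus_distr_l. rewrite E2 at 1. rewrite E3. field. lra. }
    rewrite H1, H2, <- bsum_lin.
    replace (bsum n (fun m j => rfact d m * rfact (c - d) (S j) * s ^ m) +
             bsum n (fun m j => rfact d (S m) * rfact (c - d) j * s ^ S m))
      with (1 * bsum n (fun m j => rfact d m * rfact (c - d) (S j) * s ^ m) +
             1 * bsum n (fun m j => rfact d (S m) * rfact (c - d) j * s ^ S m)) by ring.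
    rewrite <- bsum_lin. apply bsum_ext. intros m j Hmj.
    assert (E4 : d * rfact (d + 1) m = rfact d m * (d + INR m)) by (rewrite <- rfact_S_l; reflexivity).
    replace (- (d * (1 - s)) * (rfact (d + 1) m * rfact (c - d) j * s ^ m))
      with (- (1 - s) * (d * rfact (d + 1) m) * (rfact (c - d) j * s ^ m)) by ring.
    (* With [n = m + j] the coefficients satisfy [c + n - (1 - s)(d + m) = (c - d + j) + s (d +
       m)]. *)
    rewrite E4, <- Hmj, plus_INR. simpl. ring.
Qed.

(** The case [s = 0] of [hyp_flip], in which a single term of the right side survives. *)
Lemma chu_vandermonde (n : nat) (c d : R) : 0 < c ->
  rfact c n * bsum n (fun m _ => (-1) ^ m * rfact d m / rfact c m) = rfact (c - d) n.
Proof.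
  intros Hc. pose proof (hyp_flip n c d 0 Hc) as H.
  rewrite (bsum_ext n _ (fun m _ => (-1) ^ m * rfact d m / rfact c m)) in H
    by (intros; rewrite Rminus_0_r, pow1; ring).
  rewrite H. unfold bsum. rewrite (sum_f_R0_single _ n 0); [|lia|].
  - rewrite binom_0, Nat.sub_0_r. simpl. ring.
  - intros k _ Hk. rewrite (pow_ne_zero k Hk). ring.
Qed.

(** * Jacobi polynomials *)

Definition Jacobi_cst (a : R) (n : nat) : R := Gamma (INR n + a + 1) / (INR (fact n) * Gamma (a + 1)).

Lemma Jacobi_cstE (a : R) (n : nat) : -1 < a -> Jacobi_cst a n = rfact (a + 1) n / INR (fact n).
Proof.
  intros Ha. unfold Jacobi_cst.
  replace (INR n + a + 1) with (a + 1 + INR n) by ring. rewrite Gamma_rfact by lra.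
  pose proof (Gamma_pos (a + 1) ltac:(lra)). pose proof (fact_INR_pos n). field. lra.
Qed.

Lemma Jacobi_cst_pos (a : R) (n : nat) : -1 < a -> 0 < Jacobi_cst a n.
Proof.
  intros Ha. rewrite Jacobi_cstE by assumption.
  apply Rdiv_lt_0_compat; [apply rfact_pos; lra | apply fact_INR_pos].
Qed.

Lemma Jacobi_bsum (a b : R) (n : nat) (x : R) : -1 < a ->
  Jacobi a b n x = Jacobi_cst a n *
    bsum n (fun m _ => (-1) ^ m * rfact (INR n + a + b + 1) m / rfact (a + 1) m * ((1 - x) / 2) ^ m).
Proof.
  intros Ha. unfold Jacobi, Jacobi_cst. f_equal. apply sum_eq. intros m _. unfold binom.
  pose proof (fact_INR_pos m). pose proof (rfact_pos (a + 1) m ltac:(lra)).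
  replace ((-1) ^ m * rfact (- INR n) m / INR (fact m) *
    ((-1) ^ m * rfact (INR n + a + b + 1) m / rfact (a + 1) m * ((1 - x) / 2) ^ m))
  with (((-1) ^ m * (-1) ^ m) * (rfact (- INR n) m * rfact (INR n + a + b + 1) m /
     (rfact (a + 1) m * INR (fact m)) * ((1 - x) / 2) ^ m)) by (field; lra).
  rewrite <- Rpow_mult_distr. replace (-1 * -1) with 1 by ring. rewrite pow1. ring.
Qed.

(** The expansion at the end [-1], on which the Riemann-Liouville integral based at [-1] and the
    moments in powers of [1 + t] act term by term. *)
Lemma Jacobi_bsum_left (a b : R) (n : nat) (x : R) : -1 < a ->
  Jacobi a b n x = / INR (fact n) *
    bsum n (fun m j => rfact (INR n + a + b + 1) m * rfact (- INR n - b) j * ((1 + x) / 2) ^ m).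
Proof.
  intros Ha. rewrite Jacobi_bsum, Jacobi_cstE by assumption.
  pose proof (hyp_flip n (a + 1) (INR n + a + b + 1) ((1 + x) / 2) ltac:(lra)) as H.
  replace (a + 1 - (INR n + a + b + 1)) with (- INR n - b) in H by ring.
  replace (1 - (1 + x) / 2) with ((1 - x) / 2) in H by field.
  rewrite <- H. pose proof (fact_INR_pos n). field. lra.
Qed.

(** * Polynomial functions *)

Definition polyfun (n : nat) (f : R -> R) : Prop := exists c, forall x, f x = peval c n x.

Lemma polyfun_ext (n : nat) (f g : R -> R) : (forall x, f x = g x) -> polyfun n f -> polyfun n g.
Proof. intros H [c Hc]. exists c. intros x. now rewrite <- H. Qed.

Lemma polyfun_peval (c : nat -> R) (n : nat) : polyfun n (peval c n).
Proof. now exists c. Qed.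

Lemma peval_pad (c : nat -> R) (n : nat) (x : R) :
  peval c n x = peval (fun k => if (k <=? n)%nat then c k else 0) (S n) x.
Proof.
  unfold peval. rewrite tech5.
  replace (S n <=? n)%nat with false by (symmetry; apply Nat.leb_gt; lia).
  rewrite Rmult_0_l, Rplus_0_r. apply sum_eq. intros k Hk.
  now rewrite (proj2 (Nat.leb_le k n) Hk).
Qed.

Lemma polyfun_S (n : nat) (f : R -> R) : polyfun n f -> polyfun (S n) f.
Proof. intros [c Hc]. eexists. intros x. rewrite Hc. apply peval_pad. Qed.

Lemma polyfun_le (n m : nat) (f : R -> R) : (n <= m)%nat -> polyfun n f -> polyfun m f.
Proof. intros H Hf. induction H; [exact Hf | now apply polyfun_S]. Qed.

Lemma polyfun_lin (n : nat) (f g : R -> R) (u v : R) :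
  polyfun n f -> polyfun n g -> polyfun n (fun x => u * f x + v * g x).
Proof.
  intros [c Hc] [d Hd]. exists (fun k => u * c k + v * d k). intros x. rewrite Hc, Hd.
  unfold peval. rewrite !scal_sum, <- plus_sum. apply sum_eq. intros; ring.
Qed.

Lemma polyfun_const (n : nat) (a : R) : polyfun n (fun _ => a).
Proof. apply (polyfun_le 0); [lia|]. exists (fun _ => a). intros x. unfold peval. simpl. ring. Qed.

Lemma polyfun_scal (n : nat) (u : R) (f : R -> R) : polyfun n f -> polyfun n (fun x => u * f x).
Proof.
  intros Hf. apply (polyfun_ext n (fun x => u * f x + 0 * f x)); [intros; ring|].
  now apply polyfun_lin.
Qed.

Lemma peval_horner (c : nat -> R) (n : nat) (x : R) :
  peval c (S n) x = c 0%nat + x * peval (fun k => c (S k)) n x.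
Proof.
  unfold peval. rewrite decomp_sum by lia. simpl pred. rewrite scal_sum. simpl pow at 1.
  rewrite Rmult_1_r. f_equal. apply sum_eq. intros k _. simpl. ring.
Qed.

Lemma polyfun_mulX (n : nat) (f : R -> R) : polyfun n f -> polyfun (S n) (fun x => x * f x).
Proof.
  intros [c Hc]. exists (fun k => match k with O => 0 | S k' => c k' end).
  intros x. rewrite peval_horner, Hc, Rplus_0_l. reflexivity.
Qed.

Lemma polyfun_mul (n m : nat) (f g : R -> R) :
  polyfun n f -> polyfun m g -> polyfun (n + m) (fun x => f x * g x).
Proof.
  intros [c Hc] Hg. revert f c Hc. induction n as [|n IH]; intros f c Hc.
  - apply (polyfun_ext _ (fun x => c 0%nat * g x)); [|now apply polyfun_scal].
    intros x. rewrite Hc. unfold peval. simpl. ring.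
  - apply (polyfun_ext _ (fun x => c 0%nat * g x + 1 * (x * (peval (fun k => c (S k)) n x * g x)))).
    { intros x. rewrite Hc, peval_horner. ring. }
    apply polyfun_lin; [apply (polyfun_le m); [lia | exact Hg]|].
    apply (polyfun_mulX (n + m)). apply (IH _ (fun k => c (S k))). reflexivity.
Qed.

Lemma polyfun_sum (n m : nat) (F : nat -> R -> R) :
  (forall k, (k <= m)%nat -> polyfun n (F k)) -> polyfun n (fun x => sum_f_R0 (fun k => F k x) m).
Proof.
  induction m as [|m IH]; intros H; simpl; [now apply H|].
  apply (polyfun_ext n (fun x => 1 * sum_f_R0 (fun k => F k x) m + 1 * F (S m) x)); [intros; ring|].
  apply polyfun_lin; [apply IH; intros; apply H; lia | now apply H].
Qed.

Lemma polyfun_affine (n : nat) (f : R -> R) (p q : R) :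
  polyfun n f -> polyfun n (fun x => f (p * x + q)).
Proof.
  intros [c Hc]. revert f c Hc. induction n as [|n IH]; intros f c Hc.
  - exists c. intros x. rewrite Hc. unfold peval. simpl. ring.
  - apply (polyfun_ext _ (fun x => c 0%nat + (p * x + q) * peval (fun k => c (S k)) n (p * x + q))).
    { intros x. now rewrite Hc, peval_horner. }
    assert (Hn : polyfun n (fun x => peval (fun k => c (S k)) n (p * x + q)))
      by (apply (IH _ (fun k => c (S k))); reflexivity).
    apply (polyfun_ext _ (fun x => c 0%nat * 1 + 1 *
       (p * (x * peval (fun k => c (S k)) n (p * x + q)) + q * peval (fun k => c (S k)) n (p * x + q)))).
    { intros; ring. }
    apply polyfun_lin; [apply polyfun_const|].
    apply polyfun_lin; [now apply polyfun_mulX | now apply polyfun_S].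
Qed.

Lemma polyfun_remainder (n : nat) (f : R -> R) (a : R) : polyfun (S n) f ->
  exists g, polyfun n g /\ forall x, f x = (x - a) * g x + f a.
Proof.
  intros [c Hc]. revert f c Hc. induction n as [|n IH]; intros f c Hc.
  - exists (fun _ => c 1%nat). split; [apply polyfun_const|].
    intros x. rewrite !Hc. unfold peval. simpl. ring.
  - destruct (IH (peval (fun k => c (S k)) (S n)) (fun k => c (S k)) ltac:(reflexivity)) as [g [Hg E]].
    exists (fun x => 1 * (x * g x) + peval (fun k => c (S k)) (S n) a * 1). split.
    + apply polyfun_lin; [now apply polyfun_mulX | apply polyfun_const].
    + intros x. rewrite !Hc, !(peval_horner c (S n)), (E x). ring.
Qed.

Lemma polyfun_roots (n : nat) (f : R -> R) (y : nat -> R) : polyfun n f ->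
  (forall i j, (i < j <= n)%nat -> y i <> y j) ->
  (forall i, (i <= n)%nat -> f (y i) = 0) -> forall x, f x = 0.
Proof.
  revert f. induction n as [|n IH]; intros f Hf Hy H0 x.
  - destruct Hf as [c Hc]. rewrite <- (H0 0%nat (le_n _)), !Hc. unfold peval. simpl. ring.
  - destruct (polyfun_remainder n f (y (S n)) Hf) as [g [Hg E]].
    rewrite (E x), (H0 (S n) (le_n _)), (IH g Hg); [ring | |].
    + intros i j Hij. apply Hy. lia.
    + intros i Hi. pose proof (E (y i)) as Ei. rewrite !H0, Rplus_0_r in Ei by lia.
      symmetry in Ei. apply Rmult_integral in Ei as [Ei|Ei]; [|exact Ei].
      exfalso. apply (Hy i (S n)); [lia|]. lra.
Qed.

(** The family is triangular with nonzero leading coefficients: subtracting the multiple [r] of its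
    top member lowers the degree. *)
Lemma polyfun_expand (n : nat) (f : R -> R) (p : nat -> nat -> R) :
  (forall k, p k k <> 0) -> polyfun n f ->
  exists a, forall x, f x = sum_f_R0 (fun k => a k * peval (p k) k x) n.
Proof.
  intros Hp. revert f. induction n as [|n IH]; intros f [c Hc].
  - exists (fun _ => c 0%nat / p 0%nat 0%nat). intros x. rewrite Hc. unfold peval. simpl. field. apply Hp.
  - set (r := c (S n) / p (S n) (S n)).
    destruct (IH (fun x => f x - r * peval (p (S n)) (S n) x)) as [a Ha].
    { exists (fun k => c k - r * p (S n) k). intros x. rewrite Hc.
      unfold peval. rewrite !tech5.
      replace (c (S n)) with (r * p (S n) (S n)) by (unfold r; field; apply Hp).
      transitivity (sum_f_R0 (fun k => c k * x ^ k) n - r * sum_f_R0 (fun k => p (S n) k * x ^ k) n);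
        [ring|].
      rewrite scal_sum, <- minus_sum. apply sum_eq. intros; ring. }
    exists (fun k => if (k =? S n)%nat then r else a k). intros x. rewrite tech5, Nat.eqb_refl.
    rewrite (sum_eq _ (fun k => a k * peval (p k) k x)).
    + rewrite <- Ha. ring.
    + intros k Hk. now rewrite (proj2 (Nat.eqb_neq k (S n)) ltac:(lia)).
Qed.

Definition pderiv (c : nat -> R) (k : nat) : R := INR (S k) * c (S k).

Lemma derivable_pt_lim_peval (c : nat -> R) (n : nat) (x : R) :
  derivable_pt_lim (peval c (S n)) x (peval (pderiv c) n x).
Proof.
  induction n as [|n IH].
  - unfold peval. simpl.
    apply is_derive_Reals. auto_derive; [exact I|]. unfold pderiv. simpl. ring.
  - apply (derivable_pt_lim_plus (peval c (S n)) (fun x => c (S (S n)) * x ^ S (S n))); [exact IH|].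
    unfold pderiv. rewrite (Rmult_comm (INR (S (S n)))), Rmult_assoc.
    apply (derivable_pt_lim_scal (fun x => x ^ S (S n))). apply derivable_pt_lim_pow.
Qed.

Lemma polyfun_deriv (n : nat) (f g : R -> R) : polyfun (S n) f ->
  (forall t, derivable_pt_lim f t (g t)) -> polyfun n g.
Proof.
  intros [c Hc] H. exists (pderiv c). intros x.
  apply (uniqueness_limite f x); [apply H|].
  apply is_derive_Reals. apply (is_derive_ext (peval c (S n))); [intros; now rewrite Hc|].
  apply is_derive_Reals, derivable_pt_lim_peval.
Qed.

(** * The Jacobi differential equation *)

Definition jcoef (a b : R) (n k : nat) : R :=
  Jacobi_cst a n * (rfact (- INR n) k * rfact (INR n + a + b + 1) k / (rfact (a + 1) k * INR (fact k))).

Lemma Jacobi_peval (a b : R) (n : nat) (x : R) :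
  Jacobi a b n x = peval (jcoef a b n) n ((1 - x) / 2).
Proof.
  unfold Jacobi, peval, jcoef, Jacobi_cst. rewrite scal_sum. apply sum_eq. intros k _. ring.
Qed.

Lemma polyfun_Jacobi (a b : R) (n : nat) : polyfun n (Jacobi a b n).
Proof.
  apply (polyfun_ext n (fun x => peval (jcoef a b n) n (- / 2 * x + / 2))).
  - intros x. rewrite Jacobi_peval. f_equal. field.
  - apply (polyfun_affine n (peval (jcoef a b n) n)), polyfun_peval.
Qed.

Lemma jcoef_rec (a b : R) (n k : nat) : -1 < a ->
  (INR k + 1) * (INR k + (a + 1)) * jcoef a b n (S k) =
  (INR k - INR n) * (INR k + (INR n + a + b + 1)) * jcoef a b n k.
Proof.
  intros Ha. unfold jcoef. rewrite fact_simpl, mult_INR, S_INR.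
  simpl rfact. pose proof (rfact_pos (a + 1) k ltac:(lra)). pose proof (fact_INR_pos k).
  pose proof (pos_INR k). field. repeat split; lra.
Qed.

Lemma jcoef_gt (a b : R) (n k : nat) : (n < k)%nat -> jcoef a b n k = 0.
Proof. intros H. unfold jcoef. rewrite rfact_opp_nat by assumption. unfold Rdiv. ring. Qed.

(** For [n = 0] the base [a + b + 1] may be negative, but then the product is empty. *)
Lemma rfact_lead_pos (a b : R) (n : nat) : -1 < a -> -1 < b -> 0 < rfact (INR n + a + b + 1) n.
Proof.
  intros Ha Hb. destruct n as [|n]; [simpl; lra|].
  apply rfact_pos. rewrite S_INR. pose proof (pos_INR n). lra.
Qed.

Lemma jcoef_lead (a b : R) (n : nat) : -1 < a -> -1 < b -> jcoef a b n n <> 0.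
Proof.
  intros Ha Hb. unfold jcoef.
  pose proof (Jacobi_cst_pos a n Ha). pose proof (rfact_lead_pos a b n Ha Hb).
  pose proof (rfact_pos (a + 1) n ltac:(lra)). pose proof (fact_INR_pos n).
  pose proof (binom_diag n) as Hd. unfold binom in Hd.
  assert (rfact (- INR n) n <> 0).
  { intros E. rewrite E in Hd. unfold Rdiv in Hd. lra. }
  unfold Rdiv. repeat (first [assumption | lra | apply Rmult_integral_contrapositive_currified
    | apply Rinv_neq_0_compat]).
Qed.

Lemma peval_lin (c d : nat -> R) (u v : R) (n : nat) (s : R) :
  peval (fun k => u * c k + v * d k) n s = u * peval c n s + v * peval d n s.
Proof. unfold peval. rewrite !scal_sum, <- plus_sum. apply sum_eq. intros; ring. Qed.

(** The Euler operator [s d/ds] is diagonal on monomials; the vanishing of [c (S n)] lets both sides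
    stop at degree [n]. *)
Lemma peval_euler (c : nat -> R) (n : nat) (s : R) : c (S n) = 0 ->
  s * peval (pderiv c) n s = peval (fun k => INR k * c k) n s.
Proof.
  intros H. transitivity (peval (fun k => INR k * c k) (S n) s).
  - rewrite peval_horner. simpl (INR 0). rewrite Rmult_0_l, Rplus_0_l. reflexivity.
  - unfold peval. rewrite tech5, H. ring.
Qed.

(** Gauss' equation with parameters [-n], [d] and [g]. The Euler operator turns every term into a
    sum over the same powers [s^k], and the recursion makes each coefficient vanish. *)
Lemma hypergeometric_ode (c : nat -> R) (n : nat) (g d s : R) :
  (forall k, (n < k)%nat -> c k = 0) ->
  (forall k, (INR k + 1) * (INR k + g) * c (S k) = (INR k - INR n) * (INR k + d) * c k) ->
  s * (1 - s) * peval (pderiv (pderiv c)) n s + (g - (d - INR n + 1) * s) * peval (pderiv c) n s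
  + INR n * d * peval c n s = 0.
Proof.
  intros H0 Hrec.
  pose proof (peval_euler c n s (H0 (S n) ltac:(lia))) as E1.
  assert (E2 : s * peval (pderiv (pderiv c)) n s = peval (fun k => INR k * pderiv c k) n s).
  { apply peval_euler. unfold pderiv. rewrite H0 by lia. ring. }
  assert (E3 : s * (s * peval (pderiv (pderiv c)) n s) = peval (fun k => INR k * ((INR k - 1) * c k)) n s).
  { rewrite E2, <- (peval_euler (fun k => (INR k - 1) * c k)) by (rewrite H0 by lia; ring).
    f_equal. unfold peval. apply sum_eq. intros k _. unfold pderiv. rewrite S_INR. ring. }
  transitivity (s * peval (pderiv (pderiv c)) n s - s * (s * peval (pderiv (pderiv c)) n s)
    + g * peval (pderiv c) n s - (d - INR n + 1) * (s * peval (pderiv c) n s)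
    + INR n * d * peval c n s); [ring|].
  rewrite E3, E2, E1.
  transitivity (peval (fun k => 1 * (1 * (INR k * pderiv c k) + -1 * (INR k * ((INR k - 1) * c k)))
    + 1 * (1 * (g * pderiv c k + - (d - INR n + 1) * (INR k * c k)) + (INR n * d) * c k)) n s).
  - rewrite (peval_lin (fun k => 1 * (INR k * pderiv c k) + -1 * (INR k * ((INR k - 1) * c k)))),
      (peval_lin (fun k => INR k * pderiv c k)),
      (peval_lin (fun k => g * pderiv c k + - (d - INR n + 1) * (INR k * c k))),
      (peval_lin (pderiv c)). ring.
  - apply sum_f_R0_zero. intros k _.
    apply Rmult_eq_0_compat_r. pose proof (Hrec k) as H. unfold pderiv. rewrite S_INR.
    transitivity ((INR k + 1) * (INR k + g) * c (S k) - (INR k - INR n) * (INR k + d) * c k); [ring|].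
    rewrite H. ring.
Qed.

Lemma is_derive_peval_affine (c : nat -> R) (n : nat) (x : R) : c (S n) = 0 ->
  is_derive (fun x => peval c n ((1 - x) / 2)) x (- / 2 * peval (pderiv c) n ((1 - x) / 2)).
Proof.
  intros Hc.
  apply (is_derive_ext (fun x => peval c (S n) ((1 - x) / 2))).
  { intros t. unfold peval. rewrite tech5, Hc, Rmult_0_l, Rplus_0_r. reflexivity. }
  apply (is_derive_comp (peval c (S n)) (fun x => (1 - x) / 2)).
  - apply is_derive_Reals, derivable_pt_lim_peval.
  - auto_derive; [exact I | field].
Qed.

Lemma Jacobi_ode (a b : R) (n : nat) : -1 < a -> exists D1 D2,
  (forall x, derivable_pt_lim (Jacobi a b n) x (D1 x)) /\
  (forall x, derivable_pt_lim D1 x (D2 x)) /\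
  (forall x, (1 - x * x) * D2 x + (b - a - (a + b + 2) * x) * D1 x
             + INR n * (INR n + a + b + 1) * Jacobi a b n x = 0).
Proof.
  intros Ha. set (c := jcoef a b n).
  exists (fun x => - / 2 * peval (pderiv c) n ((1 - x) / 2)).
  exists (fun x => - / 2 * (- / 2 * peval (pderiv (pderiv c)) n ((1 - x) / 2))).
  assert (H0 : forall k, (n < k)%nat -> c k = 0) by (intros; now apply jcoef_gt).
  repeat split.
  - intros x. apply is_derive_Reals.
    apply (is_derive_ext (fun x => peval c n ((1 - x) / 2))); [intros; now rewrite Jacobi_peval|].
    apply is_derive_peval_affine, H0. lia.
  - intros x. apply is_derive_Reals.
    apply (is_derive_scal (fun x => peval (pderiv c) n ((1 - x) / 2))).
    apply is_derive_peval_affine. unfold pderiv. rewrite H0 by lia. ring.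
  - intros x. rewrite Jacobi_peval. fold c.
    pose proof (hypergeometric_ode c n (a + 1) (INR n + a + b + 1) ((1 - x) / 2) H0
      (fun k => jcoef_rec a b n k Ha)) as H.
    rewrite <- H. field.
Qed.

Lemma Jacobi_expand (a b : R) (n : nat) (f : R -> R) : -1 < a -> -1 < b -> polyfun n f ->
  exists e, forall x, f x = sum_f_R0 (fun k => e k * Jacobi a b k x) n.
Proof.
  intros Ha Hb Hf.
  destruct (polyfun_expand n (fun s => f (-2 * s + 1)) (jcoef a b)) as [e He].
  - intros k. now apply jcoef_lead.
  - now apply polyfun_affine.
  - exists e. intros x. replace (f x) with (f (-2 * ((1 - x) / 2) + 1)) by (f_equal; field).
    rewrite He. apply sum_eq. intros k _. now rewrite Jacobi_peval.
Qed.

Lemma Jacobi_1 (a b : R) (n : nat) : -1 < a -> Jacobi a b n 1 <> 0.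
Proof.
  intros Ha. rewrite Jacobi_peval. unfold peval.
  rewrite (sum_f_R0_single _ n 0); [|lia|].
  - unfold jcoef. pose proof (Jacobi_cst_pos a n Ha). simpl.
    replace (Jacobi_cst a n * (1 * 1 / (1 * 1)) * 1) with (Jacobi_cst a n) by field. lra.
  - intros k _ Hk. replace ((1 - 1) / 2) with 0 by field. rewrite pow_ne_zero by assumption. ring.
Qed.

(** * Orthogonality *)

Lemma improper_int_sum (F : nat -> R -> R) (l : nat -> R) (a b : R) (n : nat) :
  (forall k, (k <= n)%nat -> improper_int (F k) a b (l k)) ->
  improper_int (fun t => sum_f_R0 (fun k => F k t) n) a b (sum_f_R0 l n).
Proof.
  intros H. induction n as [|n IH].
  - exact (H 0%nat (le_n _)).
  - assert (H1 := improper_int_lin _ _ a b 1 1 _ _ (IH (fun k Hk => H k (le_S _ _ Hk))) (H (S n) (le_n _))).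
    rewrite !Rmult_1_l in H1. simpl.
    apply improper_intP. intros eps He.
    destruct (proj1 (improper_intP _ _ _ _) H1 eps He) as [d [Hd Hx]]. exists d. split; [exact Hd|].
    intros u v h1 h2 h3 h4. destruct (Hx u v h1 h2 h3 h4) as [J [HJ HJl]].
    exists J. split; [|exact HJl]. revert HJ. apply is_RInt_ext. intros t _. now rewrite !Rmult_1_l.
Qed.

Lemma improper_int_scal (f : R -> R) (a b c l : R) : a < b ->
  improper_int f a b l -> improper_int (fun t => c * f t) a b (c * l).
Proof.
  intros Hab H. pose proof (improper_int_lin f f a b c 0 l l H H) as H1.
  rewrite Rmult_0_l, Rplus_0_r in H1. revert H1. apply improper_int_ext; [exact Hab|].
  intros; ring.
Qed.

Definition jweight (a b : R) (f : R -> R) (t : R) : R := f t * Rpower (1 - t) a * Rpower (1 + t) b.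

Lemma jweight_moment (a b : R) (k m : nat) : -1 < a -> -1 < b ->
  improper_int (jweight a b (fun t => ((1 - t) / 2) ^ k * ((1 + t) / 2) ^ m)) (-1) 1
    (Rpower 2 (a + b + 1) * (Gamma (a + 1 + INR k) * Gamma (b + 1 + INR m) /
       Gamma (a + b + 2 + INR m + INR k))).
Proof.
  intros Ha Hb. pose proof (pos_INR k). pose proof (pos_INR m).
  pose proof (beta_Gamma (-1) 1 (a + 1 + INR k) (b + 1 + INR m) ltac:(lra) ltac:(lra) ltac:(lra)) as HB.
  apply (improper_int_scal _ _ _ (/ (2 ^ k * 2 ^ m))) in HB; [|lra].
  assert (Hk : 0 < 2 ^ k) by (apply pow_lt; lra). assert (Hm : 0 < 2 ^ m) by (apply pow_lt; lra).
  replace (Rpower 2 (a + b + 1) * (Gamma (a + 1 + INR k) * Gamma (b + 1 + INR m) /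
       Gamma (a + b + 2 + INR m + INR k))) with
    (/ (2 ^ k * 2 ^ m) * (Rpower (1 - -1) (a + 1 + INR k + (b + 1 + INR m) - 1) *
       (Gamma (a + 1 + INR k) * Gamma (b + 1 + INR m) / Gamma (a + 1 + INR k + (b + 1 + INR m))))).
  - revert HB. apply improper_int_ext; [lra|]. intros t Ht. unfold beta_kernel, jweight.
    replace (a + 1 + INR k - 1) with (a + INR k) by ring.
    replace (b + 1 + INR m - 1) with (b + INR m) by ring.
    replace (t - -1) with (1 + t) by ring.
    rewrite !Rpower_plus, !Rpower_pow by lra. unfold Rdiv. rewrite !Rpow_mult_distr, !pow_inv.
    field. lra.
  - replace (1 - -1) with 2 by ring.
    replace (a + 1 + INR k + (b + 1 + INR m) - 1) with (a + b + 1 + INR k + INR m) by ring.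
    replace (a + 1 + INR k + (b + 1 + INR m)) with (a + b + 2 + INR m + INR k) by ring.
    rewrite (Rpower_plus _ (INR m)), (Rpower_plus _ (INR k)), !Rpower_pow by lra.
    pose proof (Gamma_pos (a + b + 2 + INR m + INR k) ltac:(lra)). field. lra.
Qed.

(** The expansion at [1] integrates to Beta values, which add up by Chu-Vandermonde with
    [c - d = m + 1 - n]. The resulting factor [(m + 1 - n)_n] vanishes for [m < n], which is
    orthogonality, and equals [n!] for [m = n], which gives the norm. *)
Lemma Jacobi_moment (a b : R) (n m : nat) : -1 < a -> -1 < b ->
  improper_int (jweight a b (fun t => Jacobi a b n t * ((1 + t) / 2) ^ m)) (-1) 1
    (Rpower 2 (a + b + 1) * (Gamma (INR n + a + 1) / INR (fact n)) *
     (Gamma (b + 1 + INR m) / Gamma (a + b + 2 + INR m)) *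
     (rfact (INR m + 1 - INR n) n / rfact (a + b + 2 + INR m) n)).
Proof.
  intros Ha Hb. pose proof (pos_INR m).
  set (d := INR n + a + b + 1). set (c := a + b + 2 + INR m).
  assert (Hc : 0 < c) by (unfold c; lra).
  set (q := fun k => Jacobi_cst a n * (binom n k * ((-1) ^ k * rfact d k / rfact (a + 1) k))).
  replace (Rpower 2 (a + b + 1) * (Gamma (INR n + a + 1) / INR (fact n)) *
     (Gamma (b + 1 + INR m) / Gamma c) * (rfact (INR m + 1 - INR n) n / rfact c n))
    with (sum_f_R0 (fun k => q k * (Rpower 2 (a + b + 1) *
       (Gamma (a + 1 + INR k) * Gamma (b + 1 + INR m) / Gamma (c + INR k)))) n).
  - apply (improper_int_ext (fun t => sum_f_R0 (fun k => q k *
      jweight a b (fun t => ((1 - t) / 2) ^ k * ((1 + t) / 2) ^ m) t) n)); [lra | |].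
    + intros t _. unfold jweight. rewrite Jacobi_bsum by assumption. fold d. unfold bsum, q.
      transitivity (Jacobi_cst a n * (((1 + t) / 2) ^ m * Rpower (1 - t) a * Rpower (1 + t) b) *
        sum_f_R0 (fun k => binom n k * ((-1) ^ k * rfact d k / rfact (a + 1) k * ((1 - t) / 2) ^ k)) n);
        [|ring].
      rewrite scal_sum. apply sum_eq. intros k _. ring.
    + apply (improper_int_sum (fun k t => q k *
        jweight a b (fun t => ((1 - t) / 2) ^ k * ((1 + t) / 2) ^ m) t)).
      intros k _. apply improper_int_scal; [lra|]. now apply jweight_moment.
  - pose proof (chu_vandermonde n c d Hc) as HC.
    replace (INR m + 1 - INR n) with (c - d) by (unfold c, d; ring). rewrite <- HC.
    pose proof (rfact_pos c n Hc). pose proof (Gamma_pos c Hc). pose proof (fact_INR_pos n).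
    pose proof (Gamma_pos (a + 1) ltac:(lra)) as Hga.
    transitivity (Rpower 2 (a + b + 1) * (Gamma (INR n + a + 1) / INR (fact n)) *
      (Gamma (b + 1 + INR m) / Gamma c) * bsum n (fun m0 _ => (-1) ^ m0 * rfact d m0 / rfact c m0));
      [|field; lra].
    unfold bsum. rewrite scal_sum. apply sum_eq. intros k _. unfold q, Jacobi_cst.
    rewrite !Gamma_rfact by lra. pose proof (rfact_pos c k Hc). pose proof (rfact_pos (a + 1) k ltac:(lra)).
    field. repeat split; lra.
Qed.

Lemma gamJ_pos (a b : R) (n : nat) : -1 < a -> -1 < b -> 0 < gamJ a b n.
Proof.
  intros Ha Hb. pose proof (Rpower_pos 2 (a + b + 1)).
  destruct n as [|n].
  - unfold gamJ. pose proof (Gamma_pos (a + 1) ltac:(lra)). pose proof (Gamma_pos (b + 1) ltac:(lra)).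
    pose proof (Gamma_pos (a + b + 2) ltac:(lra)).
    apply Rdiv_lt_0_compat; repeat apply Rmult_lt_0_compat; assumption.
  - unfold gamJ. rewrite !S_INR. pose proof (pos_INR n).
    pose proof (Gamma_pos (INR n + 1 + a + 1) ltac:(lra)).
    pose proof (Gamma_pos (INR n + 1 + b + 1) ltac:(lra)).
    pose proof (Gamma_pos (INR n + 1 + a + b + 1) ltac:(lra)). pose proof (fact_INR_pos (S n)).
    apply Rdiv_lt_0_compat; repeat apply Rmult_lt_0_compat; try assumption. lra.
Qed.

(** The right side is the leading coefficient of [P_n] in powers of [(1 + x)/2] times the moment of
    order [n], the form in which the norm arises. *)
Lemma gamJ_eq (a b : R) (n : nat) : -1 < a -> -1 < b ->
  gamJ a b n = / INR (fact n) * rfact (INR n + a + b + 1) n *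
   (Rpower 2 (a + b + 1) * (Gamma (INR n + a + 1) / INR (fact n)) *
     (Gamma (b + 1 + INR n) / Gamma (a + b + 2 + INR n)) *
     (INR (fact n) / rfact (a + b + 2 + INR n) n)).
Proof.
  intros Ha Hb. pose proof (pos_INR n). pose proof (fact_INR_pos n) as Hf.
  pose proof (Gamma_pos (a + b + 2 + INR n) ltac:(lra)) as HG.
  pose proof (rfact_pos (a + b + 2 + INR n) n ltac:(lra)) as Hr.
  destruct n as [|n].
  - unfold gamJ. simpl in *. rewrite Rplus_0_l, !Rplus_0_r in *. field. lra.
  - unfold gamJ. set (p := INR (S n)) in *.
    assert (Hp : 1 <= p) by (unfold p; rewrite S_INR; pose proof (pos_INR n); lra).
    set (d := p + a + b + 1). assert (Hd : 0 < d) by (unfold d; lra).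
    replace (a + b + 2 + p) with (d + 1) in * by (unfold d; ring).
    replace (b + 1 + p) with (p + b + 1) by ring.
    assert (E : rfact d (S n) * (d + p) = d * rfact (d + 1) (S n)) by (rewrite <- (rfact_S_l d (S n)); reflexivity).
    rewrite (Gamma_succ d Hd) in *.
    pose proof (Gamma_pos d Hd).
    replace (2 * p + a + b + 1) with (d + p) by (unfold d; ring).
    replace (rfact d (S n)) with (d * rfact (d + 1) (S n) / (d + p)) by (rewrite <- E; field; lra).
    clear E. clearbody d. set (r := rfact (d + 1) (S n)) in *. clearbody r. set (f := INR (fact (S n))) in *. clearbody f.
    field. repeat split; lra.
Qed.

(** Expanding the factor of degree [m] at [-1] leaves moments of [P_n] of order at most [m], and
    those below [n] vanish. *)
Lemma Jacobi_orthogonal_le (a b : R) (n m : nat) : -1 < a -> -1 < b -> (m <= n)%nat ->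
  improper_int (jweight a b (fun t => Jacobi a b n t * Jacobi a b m t)) (-1) 1
    (if (n =? m)%nat then gamJ a b n else 0).
Proof.
  intros Ha Hb Hmn.
  set (q := fun k => / INR (fact m) * (binom m k * (rfact (INR m + a + b + 1) k * rfact (- INR m - b) (m - k)))).
  set (V := fun k => Rpower 2 (a + b + 1) * (Gamma (INR n + a + 1) / INR (fact n)) *
     (Gamma (b + 1 + INR k) / Gamma (a + b + 2 + INR k)) *
     (rfact (INR k + 1 - INR n) n / rfact (a + b + 2 + INR k) n)).
  assert (HV : forall k, (k < n)%nat -> V k = 0).
  { intros k Hk. unfold V.
    replace (INR k + 1 - INR n) with (- INR (n - S k)) by (rewrite minus_INR, S_INR by lia; ring).
    rewrite rfact_opp_nat by lia. unfold Rdiv. ring. }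
  replace (if (n =? m)%nat then gamJ a b n else 0) with (sum_f_R0 (fun k => q k * V k) m).
  - apply (improper_int_ext (fun t => sum_f_R0 (fun k => q k *
      jweight a b (fun t => Jacobi a b n t * ((1 + t) / 2) ^ k) t) m)); [lra | |].
    + intros t _. unfold jweight. rewrite (Jacobi_bsum_left a b m) by assumption. unfold bsum, q.
      transitivity ((Jacobi a b n t * Rpower (1 - t) a * Rpower (1 + t) b) * / INR (fact m) *
        sum_f_R0 (fun k => binom m k * (rfact (INR m + a + b + 1) k * rfact (- INR m - b) (m - k)
          * ((1 + t) / 2) ^ k)) m); [|ring].
      rewrite scal_sum. apply sum_eq. intros k _. ring.
    + apply (improper_int_sum (fun k t => q k *
        jweight a b (fun t => Jacobi a b n t * ((1 + t) / 2) ^ k) t)).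
      intros k _. apply improper_int_scal; [lra|]. now apply Jacobi_moment.
  - destruct (Nat.eqb_spec n m) as [<-|Hne].
    + rewrite (sum_f_R0_single _ n n (le_n _)).
      * unfold q, V. rewrite Nat.sub_diag, binom_diag. simpl (rfact _ 0).
        replace (INR n + 1 - INR n) with 1 by ring. rewrite rfact_1, gamJ_eq by assumption. ring.
      * intros k Hk Hkn. rewrite HV by lia. ring.
    + apply sum_f_R0_zero. intros k Hk. rewrite HV by lia. ring.
Qed.

Lemma Jacobi_orthogonal (a b : R) (n m : nat) : -1 < a -> -1 < b ->
  improper_int (jweight a b (fun t => Jacobi a b n t * Jacobi a b m t)) (-1) 1
    (if (n =? m)%nat then gamJ a b n else 0).
Proof.
  intros Ha Hb. destruct (Nat.le_ge_cases m n) as [H|H].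
  - now apply Jacobi_orthogonal_le.
  - pose proof (Jacobi_orthogonal_le a b m n Ha Hb H) as Ho. rewrite Nat.eqb_sym in Ho.
    replace (if (n =? m)%nat then gamJ a b n else 0) with (if (n =? m)%nat then gamJ a b m else 0)
      by (destruct (Nat.eqb_spec n m) as [->|_]; reflexivity).
    revert Ho. apply improper_int_ext; [lra|]. intros t _. unfold jweight. ring.
Qed.

Lemma Jacobi_coef (a b : R) (M n : nat) (e : nat -> R) : -1 < a -> -1 < b -> (n <= M)%nat ->
  improper_int (jweight a b (fun t => sum_f_R0 (fun k => e k * Jacobi a b k t) M * Jacobi a b n t))
    (-1) 1 (e n * gamJ a b n).
Proof.
  intros Ha Hb Hn.
  replace (e n * gamJ a b n) with (sum_f_R0 (fun k => e k * (if (k =? n)%nat then gamJ a b k else 0)) M).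
  - apply (improper_int_ext (fun t => sum_f_R0 (fun k => e k *
      jweight a b (fun t => Jacobi a b k t * Jacobi a b n t) t) M)); [lra | |].
    + intros t _. unfold jweight.
      transitivity ((Jacobi a b n t * Rpower (1 - t) a * Rpower (1 + t) b) *
        sum_f_R0 (fun k => e k * Jacobi a b k t) M); [|ring].
      rewrite scal_sum. apply sum_eq. intros k _. ring.
    + apply (improper_int_sum (fun k t => e k * jweight a b (fun t => Jacobi a b k t * Jacobi a b n t) t)).
      intros k _. apply improper_int_scal; [lra|]. now apply Jacobi_orthogonal.
  - rewrite (sum_f_R0_single _ M n Hn).
    + now rewrite Nat.eqb_refl.
    + intros k _ Hk. rewrite (proj2 (Nat.eqb_neq k n) Hk). ring.
Qed.

Lemma Jacobi_coef_unique (a b : R) (M : nat) (e f : nat -> R) : -1 < a -> -1 < b ->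
  (forall t, sum_f_R0 (fun k => e k * Jacobi a b k t) M = sum_f_R0 (fun k => f k * Jacobi a b k t) M) ->
  forall n, (n <= M)%nat -> e n = f n.
Proof.
  intros Ha Hb H n Hn. pose proof (gamJ_pos a b n Ha Hb).
  apply Rmult_eq_reg_r with (gamJ a b n); [|lra].
  apply (improper_int_unique (jweight a b (fun t => sum_f_R0 (fun k => e k * Jacobi a b k t) M * Jacobi a b n t))
    (-1) 1); [lra | now apply Jacobi_coef |].
  apply (improper_int_ext (jweight a b (fun t => sum_f_R0 (fun k => f k * Jacobi a b k t) M * Jacobi a b n t)));
    [lra | | now apply Jacobi_coef].
  intros t _. unfold jweight. now rewrite H.
Qed.

(** * Fractional integrals of Legendre polynomials *)

Lemma RL_monomial (rho x : R) (m : nat) : 0 < rho -> -1 < x ->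
  improper_int (fun y => Rpower (x - y) (rho - 1) * ((1 + y) / 2) ^ m) (-1) x
    (Rpower (1 + x) rho * ((1 + x) / 2) ^ m * (Gamma rho * INR (fact m) / Gamma (rho + INR m + 1))).
Proof.
  intros Hr Hx. pose proof (pos_INR m).
  pose proof (beta_Gamma (-1) x rho (INR m + 1) ltac:(lra) ltac:(lra) ltac:(lra)) as HB.
  apply (improper_int_scal _ _ _ (/ 2 ^ m)) in HB; [|lra].
  assert (Hm : 0 < 2 ^ m) by (apply pow_lt; lra).
  replace (Rpower (1 + x) rho * ((1 + x) / 2) ^ m * (Gamma rho * INR (fact m) / Gamma (rho + INR m + 1)))
   with (/ 2 ^ m * (Rpower (x - -1) (rho + (INR m + 1) - 1) *
          (Gamma rho * Gamma (INR m + 1) / Gamma (rho + (INR m + 1))))).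
  - revert HB. apply improper_int_ext; [lra|]. intros t Ht. unfold beta_kernel.
    replace (INR m + 1 - 1) with (INR m) by ring. replace (t - -1) with (1 + t) by ring.
    rewrite Rpower_pow by lra. unfold Rdiv. rewrite Rpow_mult_distr, pow_inv. ring.
  - replace (x - -1) with (1 + x) by ring. replace (rho + (INR m + 1) - 1) with (rho + INR m) by ring.
    rewrite <- Rplus_assoc, Gamma_fact, Rpower_plus, Rpower_pow by lra.
    unfold Rdiv. rewrite Rpow_mult_distr, pow_inv. ring.
Qed.

(** The expansions of the two polynomials at [-1] differ only in [(-l)_(l-m)] against
    [(-l - rho)_(l-m)]. Reversed, these are up to the same sign a quotient of factorials and a
    quotient of Gamma values, which is what integrating [(1 + y)^m] contributes. *)
Lemma RL_Legendre (rho x : R) (l : nat) : 0 < rho < 1 -> -1 < x ->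
  improper_int (fun y => Rpower (x - y) (rho - 1) * Legendre l y) (-1) x
    (Gamma rho * (INR (fact l) / Gamma (INR l + rho + 1)) * (Rpower (1 + x) rho * Jacobi (- rho) rho l x)).
Proof.
  intros Hr Hx.
  set (q := fun m => / INR (fact l) * (binom l m * (rfact (INR l + 0 + 0 + 1) m * rfact (- INR l - 0) (l - m)))).
  replace (Gamma rho * (INR (fact l) / Gamma (INR l + rho + 1)) * (Rpower (1 + x) rho * Jacobi (- rho) rho l x))
    with (sum_f_R0 (fun m => q m *
      (Rpower (1 + x) rho * ((1 + x) / 2) ^ m * (Gamma rho * INR (fact m) / Gamma (rho + INR m + 1)))) l).
  - apply (improper_int_ext (fun y => sum_f_R0 (fun m => q m * (Rpower (x - y) (rho - 1) * ((1 + y) / 2) ^ m)) l));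
      [lra | |].
    + intros y _. unfold Legendre. rewrite Jacobi_bsum_left by lra. unfold bsum, q.
      rewrite <- Rmult_assoc, scal_sum. apply sum_eq. intros m _. ring.
    + apply (improper_int_sum (fun m y => q m * (Rpower (x - y) (rho - 1) * ((1 + y) / 2) ^ m))).
      intros m _. apply improper_int_scal; [lra|]. apply RL_monomial; lra.
  - rewrite Jacobi_bsum_left by lra. unfold bsum.
    rewrite <- !Rmult_assoc, scal_sum. apply sum_eq. intros m Hm. unfold q.
    replace (INR l + - rho + rho + 1) with (INR l + 0 + 0 + 1) by ring.
    set (j := (l - m)%nat). assert (Hl : INR l = INR m + INR j) by (rewrite <- plus_INR; f_equal; unfold j; lia).
    assert (E1 : rfact (- INR l - 0) j = (-1) ^ j * rfact (INR m + 1) j).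
    { rewrite <- rfact_opp. f_equal. rewrite Hl. ring. }
    assert (E2 : rfact (- INR l - rho) j = (-1) ^ j * rfact (rho + INR m + 1) j).
    { rewrite <- rfact_opp. f_equal. rewrite Hl. ring. }
    assert (E3 : INR (fact l) = INR (fact m) * rfact (INR m + 1) j).
    { rewrite <- !rfact_1. replace l with (m + j)%nat by (unfold j; lia).
      rewrite rfact_add. do 2 f_equal. ring. }
    pose proof (pos_INR m).
    assert (E4 : Gamma (INR l + rho + 1) = Gamma (rho + INR m + 1) * rfact (rho + INR m + 1) j).
    { rewrite <- Gamma_rfact by lra. f_equal. rewrite Hl. ring. }
    rewrite E1, E2, E4.
    pose proof (Gamma_pos (rho + INR m + 1) ltac:(lra)). pose proof (rfact_pos (rho + INR m + 1) j ltac:(lra)).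
    pose proof (fact_INR_pos l). pose proof (fact_INR_pos m).
    rewrite E3 in *. field. repeat split; try lra.
    apply Rgt_not_eq, rfact_pos. lra.
Qed.

Lemma RL_int_polyfun (rho : R) (M : nat) (a : nat -> R) (u : R -> R) (x : R) :
  0 < rho < 1 -> -1 < x ->
  (forall t, u t = sum_f_R0 (fun l => a l * Legendre l t) M) ->
  RL_int rho u x = Rpower (1 + x) rho *
    sum_f_R0 (fun l => a l * (INR (fact l) / Gamma (INR l + rho + 1)) * Jacobi (- rho) rho l x) M.
Proof.
  intros Hr Hx Hu. unfold RL_int. pose proof (Gamma_pos rho ltac:(lra)) as HG.
  rewrite (IInt_eq _ (-1) x (sum_f_R0 (fun l => a l * (Gamma rho * (INR (fact l) / Gamma (INR l + rho + 1)) *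
    (Rpower (1 + x) rho * Jacobi (- rho) rho l x))) M)).
  - rewrite !scal_sum. apply sum_eq. intros l _.
    pose proof (pos_INR l). pose proof (Gamma_pos (INR l + rho + 1) ltac:(lra)). field. lra.
  - exact Hx.
  - apply (improper_int_ext (fun y => sum_f_R0 (fun l => a l * (Rpower (x - y) (rho - 1) * Legendre l y)) M)).
    + exact Hx.
    + intros y _. rewrite Hu, scal_sum. apply sum_eq. intros; ring.
    + apply (improper_int_sum (fun l y => a l * (Rpower (x - y) (rho - 1) * Legendre l y))).
      intros l _. apply improper_int_scal; [exact Hx|]. now apply RL_Legendre.
Qed.

(** * Quadrature and the Legendre coefficients *)

Lemma sum_triangle (f : nat -> nat -> R) (M : nat) :
  sum_f_R0 (fun n => sum_f_R0 (fun l => f l n) n) M =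
  sum_f_R0 (fun l => sum_f_R0 (fun k => f l (l + k)%nat) (M - l)) M.
Proof.
  induction M as [|M IH]; [reflexivity|].
  rewrite tech5, IH, (tech5 (fun l => sum_f_R0 _ _)).
  rewrite Nat.sub_diag. simpl (sum_f_R0 (fun k => f (S M) (S M + k)%nat) 0). rewrite Nat.add_0_r.
  rewrite (tech5 (fun l => f l (S M))), <- Rplus_assoc. f_equal.
  rewrite <- plus_sum. apply sum_eq. intros l Hl.
  rewrite (Nat.sub_succ_l l M) by lia. rewrite tech5. do 2 f_equal. lia.
Qed.

Definition exact_rule (N : nat) (al be : R) (x w : nat -> R) : Prop :=
  forall c : nat -> R,
    IInt (fun t => peval c (2 * N - 1) t * Rpower (1 - t) al * Rpower (1 + t) be) (-1) 1
    = sum_f_R0 (fun j => peval c (2 * N - 1) (x j) * w j) N.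

Lemma exact_rule_polyfun (N : nat) (al be : R) (x w : nat -> R) (f : R -> R) (l : R) :
  -1 < al -> -1 < be -> exact_rule N al be x w -> polyfun (2 * N - 1) f ->
  improper_int (jweight al be f) (-1) 1 l -> l = sum_f_R0 (fun i => f (x i) * w i) N.
Proof.
  intros Ha Hb Hw [c Hc] Hl.
  rewrite (sum_eq _ (fun j => peval c (2 * N - 1) (x j) * w j)) by (intros; now rewrite Hc).
  rewrite <- Hw. symmetry. apply IInt_eq; [lra|]. revert Hl. apply improper_int_ext; [lra|].
  intros t _. unfold jweight. now rewrite Hc.
Qed.

(** Common core of both formulas, used with [rho = 1 - mu], [M = N - 1] and with [rho = 2 - mu],
    [M = N - 2]. It leaves the node values of [G] open; the interpolation conditions enter
    afterwards. *)
Lemma Birkhoff_coef (N M : nat) (al be rho : R) (x w : nat -> R) (C : nat -> nat -> R) (u : R -> R) :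
  -1 < al -> -1 < be -> 0 < rho < 1 -> (M < N)%nat -> exact_rule N al be x w ->
  (forall (n : nat) (t : R),
     Jacobi al be n t = sum_f_R0 (fun l => C l n * Jacobi (- rho) rho l t) n) ->
  polyfun M u ->
  exists a G, polyfun M G /\
    (forall y, -1 < y -> RL_int rho u y = Rpower (1 + y) rho * G y) /\
    (forall t, u t = sum_f_R0 (fun l => a l * Legendre l t) M) /\
    (forall l, (l <= M)%nat -> a l = Gamma (INR l + rho + 1) / INR (fact l) *
       sum_f_R0 (fun k => C l (l + k)%nat * (/ gamJ al be (l + k) *
         sum_f_R0 (fun i => G (x i) * Jacobi al be (l + k) (x i) * w i) N)) (M - l)).
Proof.
  intros Ha Hb Hr HM Hw HC Hu.
  destruct (Jacobi_expand 0 0 M u ltac:(lra) ltac:(lra) Hu) as [a Hua].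
  set (b := fun l => a l * (INR (fact l) / Gamma (INR l + rho + 1))).
  set (G := fun y => sum_f_R0 (fun l => b l * Jacobi (- rho) rho l y) M).
  assert (HG : polyfun M G).
  { apply (polyfun_sum M M (fun l y => b l * Jacobi (- rho) rho l y)). intros k Hk.
    apply polyfun_scal. apply (polyfun_le k); [exact Hk | apply polyfun_Jacobi]. }
  exists a, G. split; [exact HG|]. split; [|split; [exact Hua|]].
  { intros y Hy. now apply RL_int_polyfun. }
  destruct (Jacobi_expand al be M G Ha Hb HG) as [e He].
  assert (Ee : forall n, (n <= M)%nat ->
    e n = / gamJ al be n * sum_f_R0 (fun i => G (x i) * Jacobi al be n (x i) * w i) N).
  { intros n Hn. pose proof (gamJ_pos al be n Ha Hb).
    assert (E : e n * gamJ al be n = sum_f_R0 (fun i => (G (x i) * Jacobi al be n (x i)) * w i) N).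
    { apply (exact_rule_polyfun N al be x w (fun t => G t * Jacobi al be n t)); try assumption.
      (* The degree is at most [M + n <= 2M <= 2N - 2], within the exactness of the rule. *)
      - apply (polyfun_le (M + n)); [lia|]. apply polyfun_mul; [exact HG | apply polyfun_Jacobi].
      - pose proof (Jacobi_coef al be M n e Ha Hb Hn) as Hj. revert Hj.
        apply improper_int_ext; [lra|]. intros t _. unfold jweight. now rewrite He. }
    rewrite <- E. field. lra. }
  intros l Hl.
  assert (Eb : b l = sum_f_R0 (fun k => C l (l + k)%nat * e (l + k)%nat) (M - l)).
  { apply (Jacobi_coef_unique (- rho) rho M b
      (fun l => sum_f_R0 (fun k => C l (l + k)%nat * e (l + k)%nat) (M - l))); try lra; [|exact Hl].
    intros t. change (G t = sum_f_R0 (fun k => sum_f_R0 (fun k0 => C k (k + k0)%nat * e (k + k0)%nat) (M - k)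
      * Jacobi (- rho) rho k t) M). rewrite He.
    (* Both expansions of [G] become sums over the pairs [l <= n], and [n = l + k] exchanges the
       order of summation. *)
    transitivity (sum_f_R0 (fun n => sum_f_R0 (fun l => C l n * e n * Jacobi (- rho) rho l t) n) M).
    - apply sum_eq. intros n _. rewrite HC, scal_sum. apply sum_eq. intros; ring.
    - rewrite (sum_triangle (fun l n => C l n * e n * Jacobi (- rho) rho l t)).
      apply sum_eq. intros k _. rewrite Rmult_comm, scal_sum. apply sum_eq. intros; ring. }
  rewrite (sum_eq _ (fun k => C l (l + k)%nat * e (l + k)%nat)).
  - rewrite <- Eb. unfold b. pose proof (fact_INR_pos l). pose proof (pos_INR l).
    pose proof (Gamma_pos (INR l + rho + 1) ltac:(lra)). field. lra.
  - intros k Hk. rewrite Ee by lia. reflexivity.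
Qed.

(** * Lagrange polynomials at the Jacobi-Gauss-Lobatto nodes *)

Lemma polyfun_derivable (n : nat) (f : R -> R) (t : R) : polyfun n f ->
  exists l, derivable_pt_lim f t l.
Proof.
  intros Hf. destruct (polyfun_S n f Hf) as [c Hc]. exists (peval (pderiv c) n t).
  apply is_derive_Reals. apply (is_derive_ext (peval c (S n))); [intros; now rewrite Hc|].
  apply is_derive_Reals, derivable_pt_lim_peval.
Qed.

(** The quotient takes the value of the derivative at its removable singularity; this is how [P_N'']
    enters the Lagrange polynomials. *)
Lemma polyfun_root_factor (n : nat) (f : R -> R) (a f1 : R) : polyfun (S n) f -> f a = 0 ->
  derivable_pt_lim f a f1 ->
  exists g, polyfun n g /\ (forall t, f t = (t - a) * g t) /\ g a = f1.
Proof.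
  intros Hf H0 Hd. destruct (polyfun_remainder n f a Hf) as [g [Hg E]].
  exists g. split; [exact Hg|]. split; [intros t; rewrite E, H0; ring|].
  destruct (polyfun_derivable n g a Hg) as [l Hl].
  apply (uniqueness_limite f a); [|exact Hd].
  apply is_derive_Reals. apply (is_derive_ext (fun t => (t - a) * g t)).
  { intros t. change ((t - a) * g t = f t). rewrite (E t), H0. ring. }
  replace (g a) with (1 * g a + (a - a) * l) by ring.
  assert (H1 : is_derive (fun t => t - a) a 1) by (auto_derive; [exact I | ring]).
  apply (is_derive_mult (fun t => t - a) g); [exact H1 | now apply is_derive_Reals | intros; apply Rmult_comm].
Qed.

(** [M] common zeros determine a polynomial of degree at most [M] up to a scalar; the crosswise form
    avoids a quotient. *)
Lemma polyfun_proportional (M : nat) (y : nat -> R) (k : nat) (G V : R -> R) :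
  polyfun M G -> polyfun M V -> (k <= M)%nat ->
  (forall i j, (i < j <= M)%nat -> y i <> y j) ->
  (forall i, (i <= M)%nat -> i <> k -> G (y i) = 0) ->
  (forall i, (i <= M)%nat -> i <> k -> V (y i) = 0) ->
  forall z, G z * V (y k) = G (y k) * V z.
Proof.
  intros HG HV Hk Hy G0 V0 z.
  assert (E : V (y k) * G z + - G (y k) * V z = 0).
  { apply (polyfun_roots M (fun z => V (y k) * G z + - G (y k) * V z) y);
      [now apply polyfun_lin | exact Hy |].
    intros i Hi. destruct (Nat.eq_dec i k) as [->|Hik]; [ring|].
    rewrite (G0 i), (V0 i) by assumption. ring. }
  lra.
Qed.

(** For [al, be > -1] the derivative of [P_N] has degree [N - 1], so [N - 1] distinct interior
    critical points are all of its zeros. *)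
Definition JGL_nodes (N : nat) (al be : R) (x : nat -> R) : Prop :=
  x 0%nat = -1 /\ x N = 1 /\ (forall j, (j < N)%nat -> x j < x (S j)) /\
  (forall j, (0 < j < N)%nat -> derivable_pt_lim (Jacobi al be N) (x j) 0).

Lemma JGL_increasing (N : nat) (al be : R) (x : nat -> R) : JGL_nodes N al be x ->
  forall i j, (i < j <= N)%nat -> x i < x j.
Proof.
  intros (_ & _ & H & _) i j Hij. destruct Hij as [Hij HjN].
  induction Hij as [|j Hij IH]; [apply H; lia|].
  apply Rlt_trans with (x j); [apply IH; lia | apply H; lia].
Qed.

(** The Jacobi equation loses a term at every node: the first derivative vanishes at the interior
    ones, the factor [1 - x^2] at the ends. The witness for [lam] is the eigenvalue
    [N (N + al + be + 1)]. *)
Lemma JGL_derivatives (N : nat) (al be : R) (x : nat -> R) : (2 <= N)%nat -> -1 < al -> -1 < be ->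
  JGL_nodes N al be x ->
  exists D1 D2 lam, 0 < lam /\ polyfun (N - 1) D1 /\
    (forall t, derivable_pt_lim D1 t (D2 t)) /\
    (forall j, (0 < j < N)%nat -> D1 (x j) = 0) /\
    (forall j, (0 < j < N)%nat -> (1 - x j * x j) * D2 (x j) = - lam * Jacobi al be N (x j)) /\
    2 * (be + 1) * D1 (-1) = - lam * Jacobi al be N (-1) /\
    2 * (al + 1) * D1 1 = lam * Jacobi al be N 1 /\
    (forall j, (0 < j <= N)%nat -> Jacobi al be N (x j) <> 0).
Proof.
  intros HN Ha Hb Hx. pose proof (JGL_increasing N al be x Hx) as Hinc.
  destruct Hx as (Hx0 & HxN & Hxi & Hxd).
  destruct (Jacobi_ode al be N Ha) as (D1 & D2 & HD1 & HD2 & Hode).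
  set (lam := INR N * (INR N + al + be + 1)) in *.
  assert (HNR : 2 <= INR N) by (replace 2 with (INR 2) by (simpl; ring); now apply le_INR).
  assert (Hlam : 0 < lam) by (apply Rmult_lt_0_compat; lra).
  assert (HP : polyfun (N - 1) D1).
  { apply (polyfun_deriv (N - 1) (Jacobi al be N)); [|exact HD1].
    replace (S (N - 1)) with N by lia. apply polyfun_Jacobi. }
  assert (Hz : forall j, (0 < j < N)%nat -> D1 (x j) = 0).
  { intros j Hj. apply (uniqueness_limite (Jacobi al be N) (x j)); auto. }
  assert (Hs : forall j, (0 < j < N)%nat -> (1 - x j * x j) * D2 (x j) = - lam * Jacobi al be N (x j)).
  { intros j Hj. pose proof (Hode (x j)) as E. rewrite (Hz j Hj) in E. lra. }
  assert (H1 : 2 * (al + 1) * D1 1 = lam * Jacobi al be N 1) by (pose proof (Hode 1); lra).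
  exists D1, D2, lam. repeat split; try assumption.
  - pose proof (Hode (-1)). lra.
  - intros j Hj. destruct (Nat.eq_dec j N) as [->|HjN]; [rewrite HxN; now apply Jacobi_1|].
    (* If [P_N] vanished at an interior node, the equation would make that node a double zero of
       [P_N']. Then [P_N'] would have too many zeros and vanish identically, against its value at
       [1]. *)
    intros E.
    assert (Hd2 : D2 (x j) = 0).
    { pose proof (Hs j ltac:(lia)) as Es. rewrite E, Rmult_0_r in Es.
      apply Rmult_integral in Es as [Es|Es]; [exfalso|exact Es].
      pose proof (Hinc 0%nat j ltac:(lia)). pose proof (Hinc j N ltac:(lia)).
      rewrite Hx0, HxN in *. assert (0 < (1 - x j) * (1 + x j)) by (apply Rmult_lt_0_compat; lra). lra. }
    destruct (polyfun_root_factor (N - 2) D1 (x j) (D2 (x j))) as (V & HV & EV & Vj).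
    { replace (S (N - 2)) with (N - 1)%nat by lia. exact HP. }
    { apply Hz. lia. }
    { apply HD2. }
    rewrite Hd2 in Vj.
    assert (V0 : forall t, V t = 0).
    { apply (polyfun_roots (N - 2) V (fun i => x (S i)) HV).
      - intros i k Hik. apply Rlt_not_eq, Hinc. lia.
      - intros i Hi. destruct (Nat.eq_dec (S i) j) as [->|Hij]; [exact Vj|].
        pose proof (EV (x (S i))) as Ei. rewrite Hz in Ei by lia.
        symmetry in Ei. apply Rmult_integral in Ei as [Ei|Ei]; [exfalso|exact Ei].
        destruct (Nat.lt_gt_cases (S i) j) as [Hc _]. destruct (Hc Hij) as [Hlt|Hlt].
        + pose proof (Hinc (S i) j ltac:(lia)). lra.
        + pose proof (Hinc j (S i) ltac:(lia)). lra. }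
    rewrite EV, V0, !Rmult_0_r in H1. symmetry in H1.
    apply Rmult_integral in H1 as [H1|H1]; [lra|]. now apply (Jacobi_1 al be N Ha).
Qed.

(** [G] is compared with [V = (1 - t) P_N'(t) / (t - x_j)]. At an interior node [V (x_j)] is
    [(1 - x_j) P_N''(x_j)], but for [j = N] it is [- P_N'(1)], and the equation at [1] then brings
    in [al + 1]; this is the origin of [c_N]. *)
Lemma JGL_lagrange_left_end (N : nat) (al be : R) (x : nat -> R) (j : nat) (G : R -> R) :
  (2 <= N)%nat -> -1 < al -> -1 < be -> JGL_nodes N al be x -> (1 <= j <= N)%nat ->
  polyfun (N - 1) G -> (forall i, (1 <= i <= N)%nat -> i <> j -> G (x i) = 0) ->
  G (-1) = G (x j) * (- ((if (j =? N)%nat then al + 1 else 1) / (be + 1)) *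
     (Jacobi al be N (-1) / Jacobi al be N (x j))).
Proof.
  intros HN Ha Hb Hx Hj HG G0.
  destruct (JGL_derivatives N al be x HN Ha Hb Hx) as (D1 & D2 & lam & Hlam & HP & HD & Hz & Hs & Hm & H1 & Hnz).
  pose proof (JGL_increasing N al be x Hx) as Hinc. destruct Hx as (Hx0 & HxN & _ & _).
  pose proof (Hnz j ltac:(lia)) as Hnzj.
  set (W := fun t => (1 - t) * D1 t).
  assert (HW : polyfun (S (N - 1)) W).
  { replace (S (N - 1)) with (1 + (N - 1))%nat by lia. apply polyfun_mul; [|exact HP].
    exists (fun k => match k with O => 1 | _ => -1 end). intros t. unfold peval. simpl. ring. }
  assert (W0 : forall i, (1 <= i <= N)%nat -> W (x i) = 0).
  { intros i Hi. unfold W. destruct (Nat.eq_dec i N) as [->|HiN]; [rewrite HxN; ring|].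
    rewrite Hz by lia. ring. }
  destruct (polyfun_root_factor (N - 1) W (x j) (-1 * D1 (x j) + (1 - x j) * D2 (x j)) HW (W0 j Hj))
    as (V & HV & EV & Vj).
  { assert (Hd1 : is_derive (fun t => 1 - t) (x j) (-1)) by (auto_derive; [exact I | ring]).
    apply is_derive_Reals. apply (is_derive_mult (fun t => 1 - t) D1).
    - exact Hd1.
    - apply is_derive_Reals, HD.
    - intros; apply Rmult_comm. }
  assert (Hneq : forall i k, (i < k <= N)%nat -> x i <> x k) by (intros; apply Rlt_not_eq, Hinc; lia).
  assert (V0 : forall i, (1 <= i <= N)%nat -> i <> j -> V (x i) = 0).
  { intros i Hi Hij. pose proof (EV (x i)) as Ei. rewrite W0 in Ei by assumption.
    symmetry in Ei. apply Rmult_integral in Ei as [Ei|Ei]; [exfalso|exact Ei].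
    destruct (proj1 (Nat.lt_gt_cases i j) Hij).
    - apply (Hneq i j); [lia | lra].
    - apply (Hneq j i); [lia | lra]. }
  pose proof (polyfun_proportional (N - 1) (fun i => x (S i)) (j - 1) G V HG HV ltac:(lia)) as Hprop.
  cbv beta in Hprop. replace (S (j - 1)) with j in Hprop by lia.
  specialize (Hprop ltac:(intros; apply Hneq; lia) ltac:(intros; apply G0; lia)
    ltac:(intros; apply V0; lia) (-1)).
  pose proof (EV (-1)) as Em. unfold W in Em.
  assert (Hxj : -1 < x j) by (rewrite <- Hx0; apply Hinc; lia).
  rewrite Vj in Hprop.
  assert (EVm : V (-1) = lam * Jacobi al be N (-1) / ((be + 1) * (1 + x j))).
  { apply Rmult_eq_reg_l with ((be + 1) * (-1 - x j)).
    - rewrite Rmult_assoc, <- Em.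
      transitivity (2 * (be + 1) * D1 (-1)); [ring|]. rewrite Hm. field. lra.
    - apply Rmult_integral_contrapositive_currified; lra. }
  rewrite EVm in Hprop.
  destruct (Nat.eqb_spec j N) as [->|HjN].
  - rewrite HxN in *.
    assert (ED : D1 1 = lam * Jacobi al be N 1 / (2 * (al + 1))) by (rewrite <- H1; field; lra).
    rewrite ED in Hprop.
    apply Rmult_eq_reg_r with (-1 * (lam * Jacobi al be N 1 / (2 * (al + 1))) + (1 - 1) * D2 1).
    + rewrite Hprop. field. repeat split; lra.
    + replace (-1 * (lam * Jacobi al be N 1 / (2 * (al + 1))) + (1 - 1) * D2 1)
        with (- (lam * / (2 * (al + 1)) * Jacobi al be N 1)) by (field; lra).
      apply Ropp_neq_0_compat, Rmult_integral_contrapositive_currified; [|exact Hnzj].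
      apply Rmult_integral_contrapositive_currified; [lra|]. apply Rinv_neq_0_compat. lra.
  - rewrite (Hz j) in Hprop by lia. pose proof (Hs j ltac:(lia)) as Esj.
    assert (ED : (1 - x j) * D2 (x j) = - lam * Jacobi al be N (x j) / (1 + x j))
      by (rewrite <- Esj; field; lra).
    rewrite ED, Rmult_0_r, Rplus_0_l in Hprop.
    apply Rmult_eq_reg_r with (- lam * Jacobi al be N (x j) / (1 + x j)).
    + rewrite Hprop. field. repeat split; lra.
    + unfold Rdiv. repeat (first [assumption | lra | apply Rmult_integral_contrapositive_currified
        | apply Rinv_neq_0_compat]).
Qed.

(** Now [1] carries no condition and the degree is one lower, so the comparison is with
    [V = P_N'(t) / (t - x_j)], evaluated at both ends. *)
Lemma JGL_interior_lagrange_ends (N : nat) (al be : R) (x : nat -> R) (j : nat) (G : R -> R) :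
  (2 <= N)%nat -> -1 < al -> -1 < be -> JGL_nodes N al be x -> (1 <= j <= N - 1)%nat ->
  polyfun (N - 2) G -> (forall i, (1 <= i <= N - 1)%nat -> i <> j -> G (x i) = 0) ->
  G (-1) = G (x j) * ((x j - 1) * Jacobi al be N (-1) / (2 * (be + 1) * Jacobi al be N (x j))) /\
  G 1 = G (x j) * - ((1 + x j) * Jacobi al be N 1 / (2 * (al + 1) * Jacobi al be N (x j))).
Proof.
  intros HN Ha Hb Hx Hj HG G0.
  destruct (JGL_derivatives N al be x HN Ha Hb Hx) as (D1 & D2 & lam & Hlam & HP & HD & Hz & Hs & Hm & H1 & Hnz).
  pose proof (JGL_increasing N al be x Hx) as Hinc. destruct Hx as (Hx0 & HxN & _ & _).
  pose proof (Hnz j ltac:(lia)) as Hnzj.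
  assert (Hxj : -1 < x j) by (rewrite <- Hx0; apply Hinc; lia).
  assert (Hxj1 : x j < 1) by (rewrite <- HxN; apply Hinc; lia).
  destruct (polyfun_root_factor (N - 2) D1 (x j) (D2 (x j))) as (V & HV & EV & Vj).
  { replace (S (N - 2)) with (N - 1)%nat by lia. exact HP. }
  { apply Hz. lia. }
  { apply HD. }
  assert (Hneq : forall i k, (i < k <= N)%nat -> x i <> x k) by (intros; apply Rlt_not_eq, Hinc; lia).
  assert (V0 : forall i, (1 <= i <= N - 1)%nat -> i <> j -> V (x i) = 0).
  { intros i Hi Hij. pose proof (EV (x i)) as Ei. rewrite Hz in Ei by lia.
    symmetry in Ei. apply Rmult_integral in Ei as [Ei|Ei]; [exfalso|exact Ei].
    destruct (proj1 (Nat.lt_gt_cases i j) Hij).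
    - apply (Hneq i j); [lia | lra].
    - apply (Hneq j i); [lia | lra]. }
  pose proof (polyfun_proportional (N - 2) (fun i => x (S i)) (j - 1) G V HG HV ltac:(lia)) as Hprop.
  cbv beta in Hprop. replace (S (j - 1)) with j in Hprop by lia.
  specialize (Hprop ltac:(intros; apply Hneq; lia) ltac:(intros; apply G0; lia)
    ltac:(intros; apply V0; lia)).
  rewrite Vj in Hprop.
  assert (E2 : D2 (x j) = - lam * Jacobi al be N (x j) / ((1 - x j) * (1 + x j)))
    by (rewrite <- (Hs j) by lia; field; lra).
  assert (E2n : D2 (x j) <> 0).
  { rewrite E2. unfold Rdiv. repeat (first [assumption | lra
      | apply Rmult_integral_contrapositive_currified | apply Rinv_neq_0_compat]). }
  split; apply (Rmult_eq_reg_r (D2 (x j))); try exact E2n; rewrite Hprop, E2.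
  - assert (EVm : V (-1) = lam * Jacobi al be N (-1) / (2 * (be + 1) * (1 + x j))).
    { apply Rmult_eq_reg_l with (2 * (be + 1) * (-1 - x j)).
      - rewrite Rmult_assoc, <- EV, Hm. field. lra.
      - apply Rmult_integral_contrapositive_currified; lra. }
    rewrite EVm. field. repeat split; lra.
  - assert (EVp : V 1 = lam * Jacobi al be N 1 / (2 * (al + 1) * (1 - x j))).
    { apply Rmult_eq_reg_l with (2 * (al + 1) * (1 - x j)).
      - rewrite Rmult_assoc, <- EV, H1. field. lra.
      - apply Rmult_integral_contrapositive_currified; lra. }
    rewrite EVp. field. repeat split; lra.
Qed.

(** * Integrals of polynomials *)

Lemma polyfun_continuous (n : nat) (f : R -> R) (t : R) : polyfun n f -> continuous f t.
Proof.
  intros Hf. destruct (polyfun_derivable n f t Hf) as [l Hl].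
  apply (ex_derive_continuous (V := R_NormedModule)). exists l. now apply is_derive_Reals.
Qed.

Lemma RInt_eq (f : R -> R) (a b l : R) : is_RInt f a b l -> RInt f a b = l.
Proof.
  intros Hl. unfold RInt.
  assert (pr : Riemann_integrable f a b) by (apply ex_RInt_Reals_0; now exists l).
  destruct (epsilon_spec (inhabits 0) (fun l => exists pr : Riemann_integrable f a b, RiemannInt pr = l))
    as [pr' Hpr'].
  { now exists (RiemannInt pr), pr. }
  rewrite <- Hpr', <- (RInt_Reals f a b pr'). now apply is_RInt_unique.
Qed.

Lemma is_RInt_antideriv (F f : R -> R) (n : nat) (a b : R) : polyfun n f ->
  (forall t, derivable_pt_lim F t (f t)) -> is_RInt f a b (F b - F a).
Proof.
  intros Hf HF. apply (is_RInt_derive (V := R_CompleteNormedModule) F f).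
  - intros t _. apply is_derive_Reals, HF.
  - intros t _. now apply (polyfun_continuous n).
Qed.

Lemma RInt_polyfun_sum (n M : nat) (F : nat -> R -> R) (c : nat -> R) (f : R -> R) (a b l : R) :
  (forall k, (k <= M)%nat -> polyfun n (F k)) ->
  (forall t, f t = sum_f_R0 (fun k => c k * F k t) M) -> is_RInt f a b l ->
  l = sum_f_R0 (fun k => c k * RInt (F k) a b) M.
Proof.
  intros HF Hf Hl.
  assert (HS : forall M', (M' <= M)%nat -> is_RInt (fun t => sum_f_R0 (fun k => c k * F k t) M') a b
             (sum_f_R0 (fun k => c k * RInt (F k) a b) M')).
  { assert (H1 : forall k, (k <= M)%nat -> is_RInt (fun t => c k * F k t) a b (c k * RInt (F k) a b)).
    { intros k Hk. apply (is_RInt_scal (V := R_NormedModule) (F k)).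
      assert (Hex : ex_RInt (F k) a b).
      { apply (ex_RInt_continuous (V := R_CompleteNormedModule)). intros t _.
        apply (polyfun_continuous n). now apply HF. }
      destruct Hex as [y Hy]. now rewrite (RInt_eq _ _ _ _ Hy). }
    induction M' as [|M' IH]; intros HM'; simpl; [apply H1; lia|].
    apply (is_RInt_plus (V := R_NormedModule) (fun t => sum_f_R0 (fun k => c k * F k t) M')
      (fun t => c (S M') * F (S M') t)); [apply IH; lia | apply H1; lia]. }
  rewrite <- (is_RInt_unique _ _ _ _ (HS M (le_n _))).
  rewrite <- (is_RInt_unique _ _ _ _ Hl). apply RInt_ext. intros t _. apply Hf.
Qed.

Lemma polyfun_Legendre (M l : nat) : (l <= M)%nat -> polyfun M (Legendre l).
Proof. intros H. apply (polyfun_le l); [exact H|]. apply polyfun_Jacobi. Qed.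

(** * The two representation formulas *)

Theorem theorem4p2
  (N : nat) (HN : (2 <= N)%nat) (al be : R) (Hal : -1 < al) (Hbe : -1 < be)
  (x w : nat -> R)
  (* JGL nodes: the N+1 zeros of (1-x^2) d/dx P_N^{(al,be)}, increasing *)
  (Hx0 : x 0%nat = -1) (HxN : x N = 1)
  (Hxinc : forall j, (j < N)%nat -> x j < x (S j))
  (Hxint : forall j, (0 < j < N)%nat -> derivable_pt_lim (Jacobi al be N) (x j) 0)
  (* JGL weights: exactness for all polynomials of degree <= 2N-1 *)
  (Hw : forall c : nat -> R,
      IInt (fun t => peval c (2 * N - 1) t * Rpower (1 - t) al * Rpower (1 + t) be)
           (-1) 1
      = sum_f_R0 (fun j => peval c (2 * N - 1) (x j) * w j) N) :
  (* (i) *)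
  (forall mu : R, 0 < mu < 1 ->
   forall C : nat -> nat -> R,
   (forall (n : nat) (t : R),
       Jacobi al be n t = sum_f_R0 (fun l => C l n * Jacobi (mu - 1) (1 - mu) l t) n) ->
   forall j : nat, (1 <= j <= N)%nat ->
   forall (q : nat -> R) (Q1 : R -> R),
   (forall t, derivable_pt_lim (peval q N) t (Q1 t)) ->
   peval q N (-1) = 0 ->
   (forall i, (1 <= i <= N)%nat -> caputo 1 mu Q1 (x i) = kron i j) ->
   let cj := if Nat.eqb j N then al + 1 else 1 in
   let xi := fun n : nat =>
     / gamJ al be n *
     (- (cj / (be + 1)) * (Jacobi al be N (-1) / Jacobi al be N (x j))
        * Jacobi al be n (-1) * w 0%nat
      + Jacobi al be n (x j) * w j) in
   let xib := fun l : nat =>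
     sum_f_R0 (fun k => C l (l + k)%nat * xi (l + k)%nat) (N - 1 - l) in
   forall t : R,
     peval q N t =
     / Rpower (1 + x j) (1 - mu) *
     sum_f_R0 (fun l => Gamma (INR l - mu + 2) / INR (fact l) * xib l *
                        RInt (Legendre l) (-1) t) (N - 1))
  /\
  (* (ii) *)
  (forall mu : R, 1 < mu < 2 ->
   forall C : nat -> nat -> R,
   (forall (n : nat) (t : R),
       Jacobi al be n t = sum_f_R0 (fun l => C l n * Jacobi (mu - 2) (2 - mu) l t) n) ->
   forall j : nat, (1 <= j <= N - 1)%nat ->
   forall (q : nat -> R) (Q1 Q2 : R -> R),
   (forall t, derivable_pt_lim (peval q N) t (Q1 t)) ->
   (forall t, derivable_pt_lim Q1 t (Q2 t)) ->
   peval q N (-1) = 0 -> peval q N 1 = 0 ->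
   (forall i, (1 <= i <= N - 1)%nat -> caputo 2 mu Q2 (x i) = kron i j) ->
   let xi := fun n : nat =>
     / gamJ al be n *
     ((x j - 1) * Jacobi al be N (-1) / (2 * (be + 1) * Jacobi al be N (x j))
        * Jacobi al be n (-1) * w 0%nat
      - (1 + x j) * Jacobi al be N 1 / (2 * (al + 1) * Jacobi al be N (x j))
        * Jacobi al be n 1 * w N
      + Jacobi al be n (x j) * w j) in
   let xib := fun l : nat =>
     sum_f_R0 (fun k => C l (l + k)%nat * xi (l + k)%nat) (N - 2 - l) in
   let Phi := fun (l : nat) (s : R) =>
     (1 + s) / 2 * RInt (fun t => (t - 1) * Legendre l t) (-1) 1
     + RInt (fun t => (s - t) * Legendre l t) (-1) s in
   forall t : R,
     peval q N t =
     / Rpower (1 + x j) (2 - mu) *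
     sum_f_R0 (fun l => Gamma (INR l - mu + 3) / INR (fact l) * xib l * Phi l t)
              (N - 2)).
Proof.
  assert (Hx : JGL_nodes N al be x) by (repeat split; assumption).
  pose proof (JGL_increasing N al be x Hx) as Hinc.
  assert (Hxp : forall i, (1 <= i <= N)%nat -> -1 < x i) by (intros; rewrite <- Hx0; apply Hinc; lia).
  split.
  - intros mu Hmu C HC j Hj q Q1 HQ1 Hq0 Hcap cj xi xib t.
    set (rho := 1 - mu).
    assert (HC' : forall n t, Jacobi al be n t = sum_f_R0 (fun l => C l n * Jacobi (- rho) rho l t) n).
    { intros n s. replace (- rho) with (mu - 1) by (unfold rho; ring). apply HC. }
    assert (HU : polyfun (N - 1) Q1).
    { apply (polyfun_deriv (N - 1) (peval q N)); [|exact HQ1].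
      replace (S (N - 1)) with N by lia. apply polyfun_peval. }
    destruct (Birkhoff_coef N (N - 1) al be rho x w C Q1) as (a & G & HG & HRL & HQa & Ea);
      try assumption; try lia; [unfold rho; lra|].
    assert (Gx : forall i, (1 <= i <= N)%nat -> Rpower (1 + x i) rho * G (x i) = kron i j).
    { intros i Hi. rewrite <- HRL by now apply Hxp. exact (Hcap i Hi). }
    assert (G0 : forall i, (1 <= i <= N)%nat -> i <> j -> G (x i) = 0).
    { intros i Hi Hij. pose proof (Gx i Hi) as E. unfold kron in E.
      rewrite (proj2 (Nat.eqb_neq i j) Hij) in E. pose proof (Rpower_pos (1 + x i) rho).
      apply Rmult_integral in E as [E|E]; [lra | exact E]. }
    assert (Gj : G (x j) = / Rpower (1 + x j) rho).
    { pose proof (Gx j Hj) as E. unfold kron in E. rewrite Nat.eqb_refl in E.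
      pose proof (Rpower_pos (1 + x j) rho).
      apply Rmult_eq_reg_l with (Rpower (1 + x j) rho); [|lra]. rewrite E. field. lra. }
    pose proof (JGL_lagrange_left_end N al be x j G HN Hal Hbe Hx Hj HG G0) as Gm. fold cj in Gm.
    (* Only the nodes [x_0] and [x_j] contribute to the quadrature sum, and both values of [G] are
       multiples of [G (x_j)]. *)
    assert (Exi : forall n, / gamJ al be n *
      sum_f_R0 (fun i => G (x i) * Jacobi al be n (x i) * w i) N = G (x j) * xi n).
    { intros n. rewrite decomp_sum by lia.
      rewrite (sum_f_R0_single _ (pred N) (j - 1)).
      - replace (S (j - 1)) with j by lia. rewrite Hx0, Gm. unfold xi. ring.
      - lia.
      - intros k Hk Hkj. rewrite G0 by lia. ring. }
    assert (Ea' : forall l, (l <= N - 1)%nat ->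
      a l = Gamma (INR l - mu + 2) / INR (fact l) * (G (x j) * xib l)).
    { intros l Hl. rewrite Ea by assumption.
      replace (INR l + rho + 1) with (INR l - mu + 2) by (unfold rho; ring). f_equal.
      unfold xib. rewrite scal_sum. apply sum_eq. intros k _. rewrite Exi. ring. }
    (* As [Q] vanishes at [-1], integrating the Legendre expansion of [Q'] recovers [Q]. *)
    pose proof (is_RInt_antideriv (peval q N) Q1 (N - 1) (-1) t HU HQ1) as HI.
    rewrite Hq0, Rminus_0_r in HI.
    rewrite (RInt_polyfun_sum (N - 1) (N - 1) Legendre a Q1 (-1) t _
      (fun k Hk => polyfun_Legendre (N - 1) k Hk) HQa HI).
    rewrite scal_sum. apply sum_eq. intros l Hl. rewrite Ea' by assumption. rewrite Gj. unfold rho. ring.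
  - intros mu Hmu C HC j Hj q Q1 Q2 HQ1 HQ2 Hq0 Hq1 Hcap xi xib Phi t.
    set (rho := 2 - mu).
    assert (HC' : forall n t, Jacobi al be n t = sum_f_R0 (fun l => C l n * Jacobi (- rho) rho l t) n).
    { intros n s. replace (- rho) with (mu - 2) by (unfold rho; ring). apply HC. }
    assert (HU1 : polyfun (N - 1) Q1).
    { apply (polyfun_deriv (N - 1) (peval q N)); [|exact HQ1].
      replace (S (N - 1)) with N by lia. apply polyfun_peval. }
    assert (HU : polyfun (N - 2) Q2).
    { apply (polyfun_deriv (N - 2) Q1); [|exact HQ2].
      replace (S (N - 2)) with (N - 1)%nat by lia. exact HU1. }
    destruct (Birkhoff_coef N (N - 2) al be rho x w C Q2) as (a & G & HG & HRL & HQa & Ea);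
      try assumption; try lia; [unfold rho; lra|].
    assert (Gx : forall i, (1 <= i <= N - 1)%nat -> Rpower (1 + x i) rho * G (x i) = kron i j).
    { intros i Hi. rewrite <- HRL by (apply Hxp; lia). exact (Hcap i Hi). }
    assert (G0 : forall i, (1 <= i <= N - 1)%nat -> i <> j -> G (x i) = 0).
    { intros i Hi Hij. pose proof (Gx i Hi) as E. unfold kron in E.
      rewrite (proj2 (Nat.eqb_neq i j) Hij) in E. pose proof (Rpower_pos (1 + x i) rho).
      apply Rmult_integral in E as [E|E]; [lra | exact E]. }
    assert (Gj : G (x j) = / Rpower (1 + x j) rho).
    { pose proof (Gx j Hj) as E. unfold kron in E. rewrite Nat.eqb_refl in E.
      pose proof (Rpower_pos (1 + x j) rho).
      apply Rmult_eq_reg_l with (Rpower (1 + x j) rho); [|lra]. rewrite E. field. lra. }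
    destruct (JGL_interior_lagrange_ends N al be x j G HN Hal Hbe Hx Hj HG G0) as [Gm Gp].
    (* Here both ends and [x_j] contribute, so the first and the last term of the sum are split
       off. *)
    assert (Exi : forall n, / gamJ al be n *
      sum_f_R0 (fun i => G (x i) * Jacobi al be n (x i) * w i) N = G (x j) * xi n).
    { intros n. rewrite decomp_sum by lia.
      replace (pred N) with (S (N - 2)) by lia. rewrite tech5.
      rewrite (sum_f_R0_single _ (N - 2) (j - 1)).
      - replace (S (j - 1)) with j by lia. replace (S (S (N - 2))) with N by lia.
        rewrite Hx0, HxN, Gm, Gp. unfold xi. ring.
      - lia.
      - intros k Hk Hkj. rewrite G0 by lia. ring. }
    assert (Ea' : forall l, (l <= N - 2)%nat ->
      a l = Gamma (INR l - mu + 3) / INR (fact l) * (G (x j) * xib l)).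
    { intros l Hl. rewrite Ea by assumption.
      replace (INR l + rho + 1) with (INR l - mu + 3) by (unfold rho; ring). f_equal.
      unfold xib. rewrite scal_sum. apply sum_eq. intros k _. rewrite Exi. ring. }
    assert (Hlin : forall u v, polyfun 1 (fun s => u + v * s)).
    { intros u v. exists (fun k => match k with O => u | _ => v end). intros s. unfold peval. simpl. ring. }
    assert (Hpoly : forall n u v f, polyfun n f -> polyfun (1 + n) (fun s => (u + v * s) * f s)).
    { intros n u v f Hf. now apply (polyfun_mul 1 n (fun s => u + v * s)). }
    (* Integration by parts against an affine factor, left general so as to produce both kernels of
       [Phi]. *)
    assert (Hder : forall u v s, is_derive (fun s => (u + v * s) * Q1 s - v * peval q N s) s
                                   ((u + v * s) * Q2 s)).
    { intros u v s.
      replace ((u + v * s) * Q2 s) with ((v * Q1 s + (u + v * s) * Q2 s) - v * Q1 s) by ring.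
      assert (Hd : is_derive (fun s => u + v * s) s v) by (auto_derive; [exact I | ring]).
      apply (is_derive_minus (V := R_NormedModule) (fun s => (u + v * s) * Q1 s) (fun s => v * peval q N s)).
      - apply (is_derive_mult (fun s => u + v * s) Q1);
          [exact Hd | apply is_derive_Reals, HQ2 | intros; apply Rmult_comm].
      - apply (is_derive_scal (peval q N)). apply is_derive_Reals, HQ1. }
    assert (HInt : forall u v s, (u + v * s) * Q1 s - v * peval q N s
        - ((u + v * -1) * Q1 (-1) - v * peval q N (-1))
      = sum_f_R0 (fun l => a l * RInt (fun r => (u + v * r) * Legendre l r) (-1) s) (N - 2)).
    { intros u v s.
      apply (RInt_polyfun_sum (1 + (N - 2)) (N - 2) (fun l r => (u + v * r) * Legendre l r) a
               (fun r => (u + v * r) * Q2 r)).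
      - intros k Hk. apply Hpoly. now apply polyfun_Legendre.
      - intros r. rewrite HQa, scal_sum. apply sum_eq. intros; ring.
      - apply (is_RInt_antideriv (fun s => (u + v * s) * Q1 s - v * peval q N s) _ (1 + (N - 2)) (-1) s).
        + now apply Hpoly.
        + intros r. apply is_derive_Reals, Hder. }
    assert (HRe : forall (f g : R -> R) u v, (forall r, f r = g r) -> RInt f u v = RInt g u v).
    { intros f g u v H. replace g with f; [reflexivity|].
      apply functional_extensionality, H. }
    (* The factor [r - 1] on [[-1, 1]] leaves the boundary term [2 Q'(-1)], since [Q] vanishes at
       both ends. The factor [t - r] on [[-1, t]] leaves [Q(t) - (1 + t) Q'(-1)]. Eliminating
       [Q'(-1)] yields [Q(t)] and explains the coefficient [(1 + t)/2]. *)
    pose proof (HInt (-1) 1 1) as H1. pose proof (HInt t (-1) t) as H2.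
    rewrite Hq0, Hq1 in H1. rewrite Hq0 in H2.
    transitivity ((1 + t) / 2 * sum_f_R0 (fun l => a l * RInt (fun r => (-1 + 1 * r) * Legendre l r) (-1) 1) (N - 2)
      + sum_f_R0 (fun l => a l * RInt (fun r => (t + -1 * r) * Legendre l r) (-1) t) (N - 2)).
    { rewrite <- H1, <- H2. field. }
    rewrite !scal_sum, <- plus_sum. apply sum_eq. intros l Hl. rewrite Ea' by assumption.
    unfold Phi. rewrite Gj. fold rho.
    rewrite (HRe (fun r => (-1 + 1 * r) * Legendre l r) (fun r => (r - 1) * Legendre l r)) by (intros; ring).
    rewrite (HRe (fun r => (t + -1 * r) * Legendre l r) (fun r => (t - r) * Legendre l r)) by (intros; ring).
    ring.
Qed.
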